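(* Let $d,\ell,m\ge 1$ be integers, and let $X_d$ denote either $C(\mathbb{R}^d,\mathbb{C})$ (continuous functions) or the space of complex valued distributions on $\mathbb{R}^d$. Let $\{h_1,\dots,h_\ell\}\subset\mathbb{R}^d$ be such that $h_1\mathbb{Z}+\cdots+h_\ell\mathbb{Z}$ is a dense subset of $\mathbb{R}^d$, and let $f\in X_d$. If $\Delta_{h_k}^m f=0$ for $k=1,\dots,\ell$, then there exist $N\in\mathbb{N}$ and complex numbers $a_\alpha$ (for $\alpha\in\mathbb{N}^d$, $|\alpha|<N$) such that $f(x)=\sum_{|\alpha|<N}a_\alpha x^\alpha$ for all $x\in\mathbb{R}^d$; thus $f$ is an ordinary complex valued polynomial in $d$ real variables (in the distributional case, this means that $f$ is equal, as a distribution, to the distribution defined by this polynomial function). Furthermore, if $d=1$, then $f(x)=a_0+a_1x+\cdots+a_{m-1}x^{m-1}$ for some complex numbers $a_0,\dots,a_{m-1}$, i.e. $f$ is an ordinary polynomial of degree $\le m-1$.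
   Context: For $h\in\mathbb{R}^d$, $\tau_h$ is the translation operator, $(\tau_h f)(x)=f(x+h)$ for functions and $\langle\tau_h f,\varphi\rangle=\langle f,\varphi(\cdot-h)\rangle$ for distributions $f$ and test functions $\varphi\in C_c^\infty(\mathbb{R}^d)$. $\Delta_h=\tau_h-\mathrm{id}$, and $\Delta_h^m$ is its $m$-th iterate. The set $h_1\mathbb{Z}+\cdots+h_\ell\mathbb{Z}$ is the additive subgroup of $\mathbb{R}^d$ generated by $h_1,\dots,h_\ell$. Here $\mathbb{N}$ includes $0$; for $\alpha\in\mathbb{N}^d$ and $x\in\mathbb{R}^d$, $x^\alpha=x_1^{\alpha_1}\cdots x_d^{\alpha_d}$ and $|\alpha|=\alpha_1+\cdots+\alpha_d$. A locally integrable function $g$ defines the distribution $\varphi\mapsto\int_{\mathbb{R}^d} g\varphi\,dx$. *)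

(* Defs.v *)
From HB Require Import structures.
From mathcomp Require Import all_boot all_order all_algebra.
From mathcomp Require Import all_classical all_reals all_analysis.
From mathcomp Require Import complex.

Set Implicit Arguments.
Unset Strict Implicit.
Unset Printing Implicit Defensive.

Import Order.TTheory GRing.Theory Num.Theory.
Import numFieldNormedType.Exports.

Local Open Scope classical_set_scope.
Local Open Scope ring_scope.

(* [Rcomplex R] is the field of complex numbers over [R], seen as an [R]-module
   normed by the modulus; we give it the topology of that norm. *)
Section complex_topology.
Variable R : realType.

HB.instance Definition _ :=
  PseudoMetric.copy (Rcomplex R) (pseudoMetric_normed (Rcomplex R)).
HB.instance Definition _ := isPointed.Build (Rcomplex R) 0.
HB.instance Definition _ :=
  NormedZmod_PseudoMetric_eq.Build R (Rcomplex R) erefl.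

Lemma Rcomplex_normrZ (l : R) (x : Rcomplex R) : `|l *: x| = `|l| * `|x|.
Proof.
case: x => a b; rewrite /Num.norm/= !exprMn -mulrDr sqrtrM ?sqr_ge0//.
by rewrite sqrtr_sqr.
Qed.

HB.instance Definition _ :=
  PseudoMetricNormedZmod_Lmodule_isNormedModule.Build R (Rcomplex R)
    Rcomplex_normrZ.

Lemma Rcomplex_normrM (x y : Rcomplex R) :
  `|x * y : Rcomplex R| = `|x| * `|y|.
Proof. exact: (Normc.normcM x y). Qed.

Lemma Rcomplex_scalerAr (l : R) (x y : Rcomplex R) :
  l *: (x * y) = x * (l *: y).
Proof.
case: x y => [a b] [c e].
congr (_ +i* _)%C; rewrite ?mulrDr ?mulrBr ?mulrN;
  by rewrite (mulrCA l) [l * (b * _)]mulrCA.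
Qed.

Lemma Rcomplex_mul_continuous (z : Rcomplex R) :
  continuous (fun x : Rcomplex R => z * x : Rcomplex R).
Proof.
move=> x; apply/(cvgrPdist_lt (F := nbhs x)) => e e0.
have e1 : 0 < e / (`|z| + 1) by rewrite divr_gt0// ltr_wpDl.
near=> y.
rewrite -mulrBr Rcomplex_normrM.
rewrite (@le_lt_trans _ _ ((`|z| + 1) * `|x - y|))//.
  by rewrite ler_wpM2r// lerDl.
rewrite -ltr_pdivlMl ?ltr_wpDl// mulrC.
near: y; exact: (cvgr_dist_lt (F := nbhs x)).
Unshelve. all: by end_near. Qed.

End complex_topology.

Section test_functions.
Context {R : realType} {d : nat}.
Local Notation C := (Rcomplex R).
Implicit Types (f g : 'rV[R]_d -> C) (h : 'rV[R]_d) (i : 'I_d).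

Definition translate h f : 'rV[R]_d -> C := fun x => f (x + h).

Definition partial i f : 'rV[R]_d -> C := fun x => 'D_(delta_mx ord0 i) f x.

Definition partials (s : seq 'I_d) f : 'rV[R]_d -> C := foldr partial f s.

(* [smooth f] : the partial derivatives of [f] of all orders, mixed ones in any
   order of differentiation included, exist and are continuous. *)
Definition smooth f := forall s : seq 'I_d,
  continuous (partials s f) /\
  forall i x, derivable (partials s f) x (delta_mx ord0 i).

Definition closed_support f : set 'rV[R]_d := closure [set x | f x != 0].

Record test_function := TestFunction {
  test_fun :> 'rV[R]_d -> C;
  test_smooth : smooth test_fun;
  test_compact : compact (closed_support test_fun) }.

Lemma is_derive_lin (z : C) f g (x v : 'rV[R]_d) :
  derivable f x v -> derivable g x v ->
  is_derive x v (fun x => z * f x + g x : C) (z * 'D_v f x + 'D_v g x : C).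
Proof.
move=> df dg; apply: is_deriveD; last exact: derivableP.
have zf : (fun t : R => t^-1 *: (((fun y => z * f y : C) \o shift x) (t *: v)
    - z * f x)) = (fun y : C => z * y : C) \o
    (fun t : R => t^-1 *: ((f \o shift x) (t *: v) - f x)).
  by apply/funext => t /=; rewrite -mulrBr Rcomplex_scalerAr.
have c : (fun t : R => t^-1 *: (((fun y => z * f y : C) \o shift x) (t *: v)
    - z * f x)) @ 0^' --> z * 'D_v f x.
  by rewrite zf; apply: continuous_cvg => //; exact: Rcomplex_mul_continuous.
apply: DeriveDef; first by apply/cvg_ex; exists (z * 'D_v f x).
exact: cvg_lim c.
Qed.

Lemma partials_lin (z : C) f g s : smooth f -> smooth g ->
  partials s (fun x => z * f x + g x : C) =
  (fun x => z * partials s f x + partials s g x : C).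
Proof.
move=> sf sg; elim: s => //= i s ->; apply/funext => x; rewrite /partial.
have [_ df] := sf s; have [_ dg] := sg s.
by have /@derive_val := is_derive_lin z (df i x) (dg i x).
Qed.

Lemma smooth_lin (z : C) f g : smooth f -> smooth g ->
  smooth (fun x => z * f x + g x : C).
Proof.
move=> sf sg s; rewrite partials_lin//.
have [cf df] := sf s; have [cg dg] := sg s; split=> [x|i x].
  have zf : (z * partials s f y : C) @[y --> x] --> (z * partials s f x : C).
    apply: (continuous_comp (f := partials s f) (g := fun y : C => z * y : C)).
      exact: cf.
    exact: Rcomplex_mul_continuous.
  exact: cvgD zf (cg x).
by have [] := is_derive_lin z (df i x) (dg i x).
Qed.

Lemma compact_support_lin (z : C) f g :
  compact (closed_support f) -> compact (closed_support g) ->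
  compact (closed_support (fun x => z * f x + g x : C)).
Proof.
move=> cf cg; apply: (subclosed_compact _ (compactU cf cg)).
  exact: closed_closure.
rewrite /closed_support -closureU; apply: closure_subset => x /= zfg.
have [fx0|?] := eqVneq (f x) 0; last by left.
by right; move: zfg; rewrite fx0 mulr0 add0r.
Qed.

Definition test_lin (z : C) (phi psi : test_function) : test_function :=
  TestFunction (smooth_lin z (test_smooth phi) (test_smooth psi))
    (@compact_support_lin z phi psi (@test_compact phi) (@test_compact psi)).

Lemma partials_translate h f s :
  partials s (translate h f) = translate h (partials s f).
Proof.
elim: s => //= i s ->; apply/funext => x; rewrite /partial /translate /derive.
by under eq_fun do rewrite /= -addrA.
Qed.

Lemma smooth_translate h f : smooth f -> smooth (translate h f).
Proof.
move=> sf s; rewrite partials_translate; have [cf df] := sf s; split=> [x|i x].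
  have c : {for x, continuous (fun y : 'rV[R]_d => y + h)}.
    exact: (cvgD (F := nbhs x) cvg_id (cvg_cst _)).
  exact: (continuous_comp c (cf (x + h))).
rewrite /derivable /translate.
have := df i (x + h); rewrite /derivable.
by under [in X in _ -> X]eq_fun do rewrite /= -addrA.
Qed.

Lemma compact_support_translate h f :
  compact (closed_support f) -> compact (closed_support (translate h f)).
Proof.
move=> cf; have c k : continuous (fun x : 'rV[R]_d => x + k).
  by move=> x; exact: (cvgD (F := nbhs x) cvg_id (cvg_cst _)).
have : compact ((fun x => x - h) @` closed_support f).
  by apply: continuous_compact => //; exact/continuous_subspaceT/c.
move=> /subclosed_compact; apply; first exact: closed_closure.
move=> x sx; exists (x + h); last exact: addrK.
move=> A /(c h x)/sx [y [/= fy Ay]]; by exists (y + h).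
Qed.

Definition test_translate h (phi : test_function) : test_function :=
  TestFunction (smooth_translate h (test_smooth phi))
    (@compact_support_translate h phi (@test_compact phi)).

End test_functions.
Arguments test_function : clear implicits.

Section distributions.
Context {R : realType} {d : nat}.
Local Notation C := (Rcomplex R).
Local Notation test := (test_function R d).
Implicit Types (f : 'rV[R]_d -> C) (phi psi : test) (T : test -> C).

Definition mpartial (alpha : 'I_d -> nat) f : 'rV[R]_d -> C :=
  foldr (fun i => iter (alpha i) (partial i)) f (enum 'I_d).

Definition linear_functional T := forall (z : C) phi psi,
  T (test_lin z phi psi) = z * T phi + T psi.

(* A multi-index of length at most [N] has all its entries at most [N], so it
   is a function to ['I_N.+1]. *)
Definition continuous_functional T := forall K : set 'rV[R]_d, compact K ->
  exists (c : R) (N : nat), forall phi, closed_support phi `<=` K ->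
    `|T phi| <= c * \sum_(alpha : {ffun 'I_d -> 'I_N.+1} |
                            (\sum_i alpha i <= N)%N)
                      sup [set `|mpartial (fun i => alpha i) phi x| |
                            x in [set: 'rV[R]_d]].

Record schwartz_distribution := SchwartzDistribution {
  distr_fun :> test -> C;
  distr_linear : linear_functional distr_fun;
  distr_continuous : continuous_functional distr_fun }.

Definition distr_translate (h : 'rV[R]_d) T : test -> C :=
  fun phi => T (test_translate (- h) phi).

End distributions.
Arguments schwartz_distribution : clear implicits.

Definition difference (E : zmodType) (tau : E -> E) (f : E) : E := tau f - f.

(* Lebesgue measure on [R^n], carried by [n.-tuple R], whose sigma-algebra is
   generated by the coordinates. *)
Section lebesgue_tuple.
Variable R : realType.
Local Notation tR n := (n.-tuple (measurableTypeR R)).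
Local Open Scope ereal_scope.

Definition cons_pair n (p : measurableTypeR R * tR n) : tR n.+1 :=
  [tuple of p.1 :: p.2].

Lemma measurable_cons_pair n : measurable_fun setT (@cons_pair n).
Proof. exact: (measurable_cons measurable_fst measurable_snd). Qed.

Section step.
Variables (n : nat) (mu : {sigma_finite_measure set (tR n) -> \bar R}).

Definition lebesgue_cons : set (tR n.+1) -> \bar R :=
  pushforward (@lebesgue_measure R \x mu) (@cons_pair n).

Let lebesgue_cons0 : lebesgue_cons set0 = 0.
Proof. by rewrite /lebesgue_cons /pushforward preimage_set0 measure0. Qed.

Let lebesgue_cons_ge0 A : 0 <= lebesgue_cons A.
Proof. exact: (measure_ge0 (@lebesgue_measure R \x mu)). Qed.

Let lebesgue_cons_sigma_additive : semi_sigma_additive lebesgue_cons.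
Proof.
move=> F mF tF mUF; rewrite /lebesgue_cons /pushforward preimage_bigcup.
apply: measure_semi_sigma_additive.
- by move=> k; rewrite -[X in measurable X]setTI; exact: measurable_cons_pair.
- apply/trivIsetP => /= i j _ _ ij; rewrite -preimage_setI.
  by move/trivIsetP : tF => /(_ _ _ _ _ ij) ->//; rewrite preimage_set0.
- rewrite -preimage_bigcup -[X in measurable X]setTI.
  exact: measurable_cons_pair.
Qed.

HB.instance Definition _ := isMeasure.Build _ _ _ lebesgue_cons
  lebesgue_cons0 lebesgue_cons_ge0 lebesgue_cons_sigma_additive.

Let lebesgue_cons_sigma_finite : sigma_finite setT lebesgue_cons.
Proof.
have /sigma_finiteP[F [TF ndF Foo]] := sigma_finiteT (@lebesgue_measure R).
have /sigma_finiteP[G [TG ndG Goo]] := sigma_finiteT mu.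
pose uncons (t : tR n.+1) : measurableTypeR R * tR n :=
  (thead t, [tuple of behead t]).
have unconsK p : uncons (cons_pair p) = p.
  by case: p => x t; congr pair; exact/val_inj.
have muncons : measurable_fun setT uncons.
  by apply: measurable_fun_pair; [exact: measurable_tnth|
                                  exact: measurable_behead].
exists (fun k => uncons @^-1` (F k `*` G k)).
  rewrite -preimage_bigcup (_ : \bigcup_k _ = setT) ?preimage_setT//.
  rewrite -subTset => -[x t] _.
  have [i _ Fx] : (\bigcup_k F k) x by rewrite -TF.
  have [j _ Gt] : (\bigcup_k G k) t by rewrite -TG.
  exists (maxn i j) => //; split => /=.
    by move: x Fx; exact/subsetPset/ndF/leq_maxl.
  by move: t Gt; exact/subsetPset/ndG/leq_maxr.
move=> k; have [mF muF] := Foo k; have [mG muG] := Goo k; split.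
  by rewrite -[X in measurable X]setTI; apply: muncons => //; exact: measurableX.
rewrite /lebesgue_cons /pushforward -comp_preimage.
rewrite (_ : uncons \o @cons_pair n = id); last by rewrite funeqE.
by rewrite preimage_id product_measure1E// lte_mul_pinfty// ge0_fin_numE.
Qed.

HB.instance Definition _ := Measure_isSigmaFinite.Build _ _ _ lebesgue_cons
  lebesgue_cons_sigma_finite.

End step.

Fixpoint lebesgue_tuple n : {sigma_finite_measure set (tR n) -> \bar R} :=
  match n with
  | 0 => dirac ([tuple] : tR 0)
  | n.+1 => lebesgue_cons (lebesgue_tuple n)
  end.

End lebesgue_tuple.

Section regular_distributions.
Context {R : realType} {d : nat}.
Local Notation C := (Rcomplex R).

Definition integral_rV (g : 'rV[R]_d -> C) : C :=
  let mu := lebesgue_tuple R d in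
  let pt (t : d.-tuple (measurableTypeR R)) : 'rV[R]_d :=
    \row_i tnth t i in
  Complex (\int[mu]_t complex.Re (g (pt t))) (\int[mu]_t complex.Im (g (pt t))).

Definition distr_of_fun (g : 'rV[R]_d -> C) (phi : test_function R d) : C :=
  integral_rV (fun x => g x * phi x).

(* [a] gives the coefficients of the multi-indices of length smaller than [N],
   whose entries are all smaller than [N]. *)
Definition polynomial_fun (N : nat) (a : {ffun 'I_d -> 'I_N} -> C) :
  'rV[R]_d -> C :=
  fun x => \sum_(alpha : {ffun 'I_d -> 'I_N} | (\sum_i alpha i < N)%N)
             (\prod_i x ord0 i ^+ alpha i) *: a alpha.

End regular_distributions.

(* Main.v *)
Require Import Defs.
From HB Require Import structures.
From mathcomp Require Import all_boot all_order all_algebra.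
From mathcomp Require Import all_classical all_reals all_analysis.
From mathcomp Require Import measurable_realfun complex ring lra zify.

(** Functions.  Let [Delta_h f (x) = f (x + h) - f x].  If the [m]-th difference
    of [f] vanishes for each of the steps [h_1, ..., h_l], Newton's forward formula
    ([newton_forward]), applied to one step after the other, shows that
    [n |-> f (x + n g)] is a polynomial of degree at most [D = l (m - 1)] for
    every [g] in the subgroup generated by the steps ([nat_polynomial_steps]).
    Written as a Lagrange formula, this is an identity between continuous
    functions of [g], so density extends it to all vectors
    ([lattice_line_polynomial]); refining the step then makes [f] a polynomial of
    degree at most [D] along every real line ([nat_polynomial_line]).  A function
    that is polynomial of bounded degree in each variable equals its tensor
    Lagrange interpolant ([box_polynomial]).  In dimension one the degree is
    already determined on the half-line [x + h N] of one nonzero step, where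
    Newton's formula bounds it by [m - 1] ([lattice_line_polynomial1]).

    Distributions.  Let [T] satisfy the same equations and let [f] be a test
    function.  The function [x |-> T (f (. + x))] is continuous and satisfies
    them too, hence is polynomial along lines.  Its derivative in the direction
    [i] is [x |-> T (d_i f (. + x))], so [T] vanishes on all derivatives
    [d_i^M f], where [M] bounds the degrees ([rfun_iter_pd]).  It remains to see
    that a functional with this property is a combination of the moments
    [f |-> int x^beta f(x) dx] with [beta_i < M] for all [i].

    Fix functions [rho_i] of the single variable [x_i] with integral [1].
    Subtracting [rho_i] times its integral in [x_i] from a test function gives
    a function that has a primitive of bounded support.  Repeating this [M] times
    writes the test function, modulo an [M]-fold derivative, as a combination of
    the derivatives [rho_i^(k)], [k < M], with coefficients that do not depend on
    [x_i] ([iterated_decomposition]).  Doing so in every coordinate shows that a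
    linear functional that vanishes on the derivatives [d_i^M f] is zero as soon
    as it vanishes on the products of the [rho_i^(alpha_i)] with [alpha_i < M]
    ([functional_vanish]).  The moments vanish on these derivatives as well, by
    Fubini's theorem and integration by parts ([moment_iter_pd]), and their
    values on the products form a tensor product of triangular matrices with
    nonzero diagonal; so some combination of moments takes the same values as [T]
    on the products ([moment_interpolation]) and therefore equals [T]
    ([real_representation], [distribution_polynomial]).  This is carried out on
    real test functions: [T] is complex linear, and a test function is the sum of
    its real part and [i] times its imaginary part. *)

Set Implicit Arguments.
Unset Strict Implicit.
Unset Printing Implicit Defensive.

Import Order.TTheory GRing.Theory Num.Theory.
Import numFieldNormedType.Exports.

Local Open Scope classical_set_scope.
Local Open Scope ring_scope.

(** * Functions with vanishing differences on a dense subgroup *)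

Lemma horner_natr_inj (K : numFieldType) (p q : {poly K}) :
  (forall n : nat, p.[n%:R] = q.[n%:R]) -> p = q.
Proof.
move=> pq; apply/eqP; rewrite -subr_eq0; apply/negPn/negP => pq0.
have /= := @max_poly_roots _ (p - q)
  [seq n%:R | n <- iota 0 (size (p - q))] pq0.
rewrite size_map size_iota ltnn => H; suff: false by [].
apply: H; first by apply/allP => _ /mapP[n _ ->]; rewrite /root !hornerE pq subrr.
by rewrite map_inj_uniq ?iota_uniq// => a b /eqP; rewrite eqr_nat => /eqP.
Qed.

Section lines.
Variables (R : realType) (d : nat).
Local Notation C := (Rcomplex R).
Local Notation E := 'rV[R]_d.
Local Notation Delta h := (difference (@translate R d h)).
Implicit Types (f : E -> C) (x v h g : E).

Lemma dense_eq (T : topologicalType) (A : set T) (F G : T -> C) :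
  dense A -> continuous F -> continuous G -> {in A, F =1 G} -> F =1 G.
Proof.
move=> dA cF cG FG x; apply/eqP; rewrite -subr_eq0; apply/negPn/negP => H.
have cH : continuous (fun y => F y - G y).
  move=> y; exact: cvgB (cF y) (cG y).
have oH : open ((fun y => F y - G y) @^-1` [set~ 0]).
  apply: open_comp => [y _|]; first exact: cH.
  by apply: closed_openC; apply: accessible_closed_set1;
    exact: hausdorff_accessible (@norm_hausdorff _ _).
have [|y [/= yH Ay]] := dA _ _ oH; first by exists x; exact/eqP.
by apply: yH; rewrite FG ?inE// subrr.
Qed.

Lemma differenceE h f x : Delta h f x = f (x + h) - f x.
Proof. by []. Qed.

Lemma Delta0 h : Delta h 0 = 0.
Proof. by apply/funext => x; rewrite /difference/translate !fctE subrr. Qed.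

Lemma Delta_comm h g f : Delta h (Delta g f) = Delta g (Delta h f).
Proof.
apply/funext => x; rewrite !differenceE [x + g + h]addrAC; ring.
Qed.

Lemma iter_Delta_comm h g f m n :
  iter m (Delta h) (iter n (Delta g) f) = iter n (Delta g) (iter m (Delta h) f).
Proof.
elim: m => //= m ->; move: (iter m _ f) => k.
by elim: n => //= n <-; rewrite Delta_comm.
Qed.

Lemma iter_Delta0 h n : iter n (Delta h) 0 = 0.
Proof. by elim: n => //= n ->; exact: Delta0. Qed.

Lemma iter_Delta_opp m h f :
  iter m (Delta h) f = 0 -> iter m (Delta (- h)) f = 0.
Proof.
have DN (g : E -> C) : Delta (- h) g = fun x => - (Delta h g) (x - h).
  by apply/funext => x; rewrite !differenceE subrK opprB.
have trD (g : E -> C) : Delta h (fun x => - g (x - h)) = fun x => - Delta h g (x - h).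
  by apply/funext => x; rewrite !differenceE [x - h + h]addrAC; ring.
have itr k (g : E -> C) : iter k (Delta h) (fun x => - g (x - h)) =
               fun x => - (iter k (Delta h) g) (x - h).
  by elim: k => //= k ->; rewrite trD.
elim: m f => // m IH f; rewrite iterSr => H.
rewrite iterSr DN.
have: iter m (Delta (- h)) (Delta h f) = 0 by exact: IH.
have itrN k (g : E -> C) : iter k (Delta (- h)) (fun x => - g (x - h)) =
               fun x => - (iter k (Delta (- h)) g) (x - h).
  elim: k => //= k ->; apply/funext => x.
  by rewrite !differenceE [x - h - h]addrAC; ring.
by rewrite itrN => ->; apply/funext => x; rewrite oppr0.
Qed.

(** Newton's forward formula: [tau_h = 1 + Delta_h], so the binomial formula
    expands [tau_h^n], and the terms of order at least [m] vanish. *)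
Lemma newton_forward m h f x n : iter m (Delta h) f = 0 ->
  f (x + h *+ n) = \sum_(j < m) iter j (Delta h) f x *+ 'C(n, j).
Proof.
case: m => [/= ->|m]; first by rewrite big_ord0.
elim: n f => [|n IH] f Hf.
  by rewrite mulr0n addr0 big_ord_recl big1 ?addr0//.
have -> : f (x + h *+ n.+1) = f (x + h *+ n) + Delta h f (x + h *+ n).
  by rewrite differenceE mulrSr (addrA x); ring.
rewrite IH// IH -?iterSr//; last by rewrite iterS Hf Delta0.
rewrite big_ord_recl [X in _ + X]big_ord_recr /= -iterSr Hf mul0rn addr0.
rewrite [RHS]big_ord_recl !bin0 -addrA; apply: f_equal2 => //.
rewrite -big_split; apply: eq_bigr => i _ /=.
by rewrite /bump /= !add1n binS mulrnDr -iterSr.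
Qed.

Definition nat_polynomial D (u : nat -> C) :=
  exists2 p : {poly C}, (size p <= D)%N & forall n, u n = p.[n%:R].

Lemma nat_polynomial_bin (a j : nat) :
  nat_polynomial j.+1 (fun n => 'C(n * a, j)%:R).
Proof.
pose q k : {poly C} := \prod_(i < k) (a%:R *: 'X - i%:R%:P).
have sq k : (size (q k) <= k.+1)%N.
  rewrite /q; elim: k => [|k IH]; first by rewrite big_ord0 size_poly1.
  rewrite big_ord_recr /=; apply: (leq_trans (size_polyMleq _ _)).
  have s2 : (size (a%:R *: 'X - k%:R%:P : {poly C})%R <= 2)%N.
    rewrite (leq_trans (size_polyD _ _))// geq_max size_polyN.
    rewrite (leq_trans (size_scale_leq _ _)) ?size_polyX//.
    by rewrite (leq_trans (size_polyC_leq1 _)).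
  by rewrite (leq_trans (n:= (k.+1 + 2).-1))// -?subn1 ?leq_sub2r ?leq_add// ?addn2.
have qE k n : (q k).[n%:R] = ((n * a) ^_ k)%:R.
  rewrite /q horner_prod; elim: k => [|k IH]; first by rewrite big_ord0 ffactn0.
  rewrite big_ord_recr /= IH ffactnSr !hornerE.
  have [lek|ltk] := leqP k (n * a).
    by rewrite natrM natrB// natrM [a%:R * _]mulrC.
  by rewrite ffact_small// mul0r.
exists ((j`!)%:R^-1 *: q j); first exact: leq_trans (size_scale_leq _ _) (sq j).
move=> n; rewrite hornerZ qE -bin_ffact natrM mulrC mulfK//.
Qed.

Lemma nat_polynomialM D1 D2 u1 u2 : nat_polynomial D1.+1 u1 ->
  nat_polynomial D2.+1 u2 ->
  nat_polynomial (D1 + D2).+1 (fun n => u1 n * u2 n).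
Proof.
move=> [p sp pE] [q sq qE]; exists (p * q).
  by apply: (leq_trans (size_polyMleq _ _)); move: sp sq; lia.
by move=> n; rewrite pE qE hornerM.
Qed.

Lemma nat_polynomial_le D1 D2 u :
  (D1 <= D2)%N -> nat_polynomial D1 u -> nat_polynomial D2 u.
Proof. by move=> le [p sp pE]; exists p => //; exact: leq_trans le. Qed.

Lemma nat_polynomial_sum D m (u : 'I_m -> nat -> C) :
  (forall j, nat_polynomial D (u j)) ->
  nat_polynomial D (fun n => \sum_(j < m) u j n).
Proof.
elim: m u => [|m IH] u H.
  by exists 0 => [|n]; rewrite ?size_poly0// big_ord0 horner0.
have [p sp pE] := IH (fun j => u (widen_ord (leqnSn m) j)) (fun=> H _).
have [q sq qE] := H ord_max.
exists (p + q) => [|n]; last by rewrite big_ord_recr /= hornerD pE qE.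
by rewrite (leq_trans (size_polyD _ _))// geq_max sp.
Qed.

(** Expanding one step at a time by Newton's formula, every factor contributes a
    binomial coefficient of degree less than [m] in [t]. *)
Lemma nat_polynomial_steps m (s : seq (E * nat)) f x :
  (forall p, p \in s -> iter m.+1 (Delta p.1) f = 0) ->
  nat_polynomial (size s * m).+1
    (fun t => f (x + (\sum_(p <- s) p.1 *+ p.2) *+ t)).
Proof.
elim: s f x => [|[h a] s IH] f x H.
  exists (f x)%:P => [|n]; first by rewrite mul0n size_polyC_leq1.
  by rewrite big_nil mul0rn addr0 hornerC.
have -> : (fun t => f (x + (\sum_(p <- (h, a) :: s) p.1 *+ p.2) *+ t)) =
  (fun t => \sum_(j < m.+1) 'C(t * a, j)%:R *
      iter j (Delta h) f (x + (\sum_(p <- s) p.1 *+ p.2) *+ t)).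
  apply/funext => t; rewrite big_cons mulrnDl addrCA addrC -mulrnA mulnC.
  rewrite (@newton_forward m.+1); last by apply: (H (h, a)); exact: mem_head.
  by apply: eq_bigr => j _; rewrite mulr_natl.
apply: nat_polynomial_sum => j.
apply: (@nat_polynomial_le (j + size s * m).+1).
  by rewrite /= mulSn ltnS leq_add2r -ltnS.
apply: nat_polynomialM; first exact: nat_polynomial_bin.
apply: IH => p ps; rewrite iter_Delta_comm H ?iter_Delta0//.
by rewrite inE ps orbT.
Qed.

Lemma nat_polynomial_lagrange D u : nat_polynomial D.+1 u ->
  forall n, u n = \sum_(j < D.+1) u j * (tnth (D.+1.-lagrange (fun j =>
    j%:R)) j).[n%:R].
Proof.
move=> [p sp pE] n.
have inj : injective (fun j : nat => j%:R : C) by move=> a b /eqP;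
  rewrite eqr_nat => /eqP.
rewrite pE {1}(lagrange_gen (ltn0Sn D) inj sp) horner_sum.
by apply: eq_bigr => j _; rewrite hornerM hornerC pE.
Qed.

Definition line_polynomial D f := forall x v, exists2 p : {poly C},
  (size p <= D)%N & forall s : R, f (x + s *: v) = p.[s%:A].

Lemma natA (n : nat) : (n%:R : R)%:A = n%:R :> C.
Proof. by rewrite scaler_nat. Qed.

Lemma horner_continuous_line (p : {poly C}) :
  continuous (fun s : R => p.[s%:A]).
Proof.
elim/poly_ind: p => [|p c IH].
  rewrite (_ : (fun _ => _) = fun=> 0); first exact: cst_continuous.
  by apply/funext => s; rewrite horner0.
rewrite (_ : (fun _ => _) = fun s => s *: p.[s%:A] + c).
  by move=> s; apply: cvgD (cvgZ (@cvg_id _ _) (IH s)) (cvg_cst _).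
by apply/funext => s; rewrite !hornerE mulrC mulr_algl.
Qed.

(** From the naturals to the reals: a continuous function that is polynomial of
    bounded degree along every discrete half-line [x + v N] is polynomial along
    every line.  The polynomials belonging to the finer half-lines [x + (v/q) N]
    all extend the one for [q = 1], and moving the base point to [x - k v]
    reaches the negative numbers. *)
Lemma nat_polynomial_line D f : continuous f ->
  (forall x v, nat_polynomial D (fun n => f (x + v *+ n))) ->
  line_polynomial D f.
Proof.
move=> cf H x v; have [p sp pE] := H x v; exists p => //.
suff H1 : {in range ratr, (fun s : R => f (x + s *: v)) =1 fun s => p.[s%:A]}.
  apply: (@dense_eq R (range ratr) (fun s : R => f (x + s *: v)) _ (@dense_rat R)
    _ (@horner_continuous_line p)) => // s.
  apply: (continuous_comp (f := fun s : R => x + s *: v)); last exact: cf.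
  by apply: cvgD (cvg_cst _) (cvgZ (@cvg_id _ _) (cvg_cst _)).
have natline y p' q n : (forall n, f (y + v *+ n) = p'.[n%:R]) -> (0 < q)%N ->
    f (y + (n%:R / q%:R) *: v) = p'.[(n%:R / q%:R)%:A].
  move=> p'E q0; have qR : q%:R != 0 :> R by rewrite pnatr_eq0 -lt0n.
  have [r sr rE] := H y (q%:R^-1 *: v).
  have e : r \Po (q%:R *: 'X) = p'.
    apply: horner_natr_inj => k; rewrite horner_comp !hornerE -natrM -rE.
    by rewrite -p'E -scaler_nat scalerA natrM mulrAC divff// mul1r scaler_nat.
  rewrite -[in RHS]e horner_comp hornerZ hornerX.
  rewrite (_ : q%:R * _ = n%:R) -?rE; last first.
    by rewrite -(natA q) -scalerAl mul1r scalerA mulrC divfK// natA.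
  by congr (f (_ + _)); rewrite -[RHS]scaler_nat scalerA.
move=> s; rewrite inE => -[r _ <-].
pose k := `|numq r|%N; pose b := `|denq r|%N.
have b0 : (0 < b)%N by rewrite absz_gt0 denq_neq0.
have bR : b%:R != 0 :> R by rewrite pnatr_eq0 -lt0n.
have [n nE] : exists n : nat, ratr r = n%:R / b%:R - k%:R :> R.
  exists (absz (numq r + (k * b)%N%:Z)).
  have -> : (absz (numq r + (k * b)%N%:Z))%:R = (numq r + (k * b)%N%:Z)%:~R :> R.
    by rewrite [LHS]pmulrn gez0_abs// /k /b; move: b0; rewrite /b; nia.
  rewrite intrD mulrDl -[X in _ + X / _]pmulrn natrM mulfK// addrK /ratr.
  by rewrite [X in _ = _ / X]pmulrn /b gez0_abs.
have [p' _ p'E] := H (x - v *+ k) v.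
have e : p' \Po ('X + k%:R%:P) = p.
  apply: horner_natr_inj => j; rewrite horner_comp !hornerE -natrD -p'E -pE.
  by rewrite addnC mulrnDr addrA subrK.
rewrite nE -e horner_comp !hornerE -[X in p'.[_ + X]]natA -[X in p'.[X]]scalerDl
  subrK -(natline _ _ _ _ p'E b0).
by rewrite scalerBl scaler_nat addrA addrAC.
Qed.

Lemma continuous_addMn f x n : continuous f ->
  continuous (fun v => f (x + v *+ n)).
Proof.
move=> cf v; apply: (continuous_comp (f := fun v => x + v *+ n)); last exact: cf.
apply: (cvgD (F := nbhs v)) (cvg_cst _) _; rewrite -scaler_nat.
under eq_fun do rewrite -scaler_nat.
exact: (cvgZ (F := nbhs v)) (cvg_cst _) cvg_id.
Qed.

(** With [D = ell * m], the Lagrange formula with nodes [0, ..., D] expresses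
    [f (x + n v)] by the values [f (x + j v)] for every [v] in the dense subgroup;
    both sides are continuous in [v], so it holds for every vector [v]. *)
Lemma lattice_line_polynomial m ell (h : 'I_ell -> E) f :
  dense [set x | exists n : 'I_ell -> int, x = \sum_(k < ell) h k *~ n k] ->
  continuous f -> (forall k, iter m.+1 (Delta (h k)) f = 0) ->
  line_polynomial (ell * m).+1 f.
Proof.
move=> hdense cf fD; set D := (ell * m)%N.
pose L j : {poly C} := tnth (D.+1.-lagrange (fun j => j%:R : C)) j.
have inj : injective (fun j : nat => j%:R : C).
  by move=> a b /eqP; rewrite eqr_nat => /eqP.
have lag x n : (fun v => f (x + v *+ n)) =1
    fun v => \sum_(j < D.+1) f (x + v *+ j) * (L j).[n%:R].
  apply: (@dense_eq E _ (fun v => f (x + v *+ n))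
    (fun v => \sum_(j < D.+1) f (x + v *+ j) * (L j).[n%:R]) hdense).
  - exact: continuous_addMn.
  - apply: continuous_big => [|j _ v]; first exact: (@add_continuous C).
    under eq_fun do rewrite mulrC.
    apply: (continuous_comp (g := fun z : C => (L j).[n%:R] * z)).
      exact: continuous_addMn.
    exact: Rcomplex_mul_continuous.
  move=> _ /set_mem [a ->].
  pose s := [seq (if 0 <= a k then h k else - h k, absz (a k)) | k <- enum 'I_ell].
  have -> : \sum_(k < ell) h k *~ a k = \sum_(p <- s) p.1 *+ p.2.
    rewrite big_map big_enum /=; apply: eq_bigr => k _ /=.
    case: (a k) => b /=; first by rewrite -pmulrn.
    by rewrite NegzE mulrNz mulNrn -pmulrn.
  have := @nat_polynomial_steps m s f x;
    rewrite size_map size_enum_ord => /(_ _)/nat_polynomial_lagrange; apply.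
  move=> _ /mapP[k _ ->] /=; case: ifP => _; first exact: fD.
  exact: (@iter_Delta_opp m.+1 _ _ (fD k)).
apply: nat_polynomial_line => // x v.
exists (\sum_(j < D.+1) f (x + v *+ j) *: L j).
  rewrite (leq_trans (size_sum _ _ _))//; apply/bigmax_leqP => j _.
  by rewrite (leq_trans (size_scale_leq _ _))// size_lagrange_.
move=> n; rewrite lag horner_sum; apply: eq_bigr => j _.
by rewrite hornerZ.
Qed.

Local Notation ee i := (delta_mx ord0 i : E).
Local Notation monomial x alpha := (\prod_i x ord0 i ^+ alpha i).

Lemma addZ_delta x s i j : (x + s *: ee i) ord0 j = x ord0 j + s *+ (j == i).
Proof. by rewrite !mxE eqxx /= mulr_natr. Qed.

(** With all but one coordinate on the grid, the function is a polynomial of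
    degree at most [D] in that coordinate with [D + 1] roots; the coordinates
    leave the grid one after the other. *)
Lemma grid_vanish D f :
  (forall x i, exists2 p : {poly C}, (size p <= D.+1)%N &
     forall s : R, f (x + s *: ee i) = p.[s%:A]) ->
  (forall beta : {ffun 'I_d -> 'I_D.+1}, f (\row_i (beta i)%:R) = 0) ->
  forall x, f x = 0.
Proof.
move=> fp f0 x.
suff H k : (k <= d)%N -> forall x, (forall i : 'I_d, (k <= i)%N ->
    exists j : 'I_D.+1, x ord0 i = j%:R) -> f x = 0.
  by apply: (H d) => // i; rewrite leqNgt ltn_ord.
elim: k => [_ y Hy|k IH kd y Hy].
  have /choice[b bE] : forall i, exists j : 'I_D.+1, y ord0 i = j%:R.
    by move=> i; exact: Hy.
  rewrite -(f0 (finfun b)); congr f.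
  by apply/rowP => i; rewrite !mxE bE ffunE.
have [p sp pE] := fp y (Ordinal kd).
have p0 : p = 0.
  apply/eqP/negPn/negP => p0.
  pose c : R := y ord0 (Ordinal kd).
  have := @max_poly_roots _ p
    [seq ((nat_of_ord j)%:R - c)%:A | j <- enum 'I_D.+1] p0.
  rewrite size_map size_enum_ord ltnNge sp => H; suff: false by []. apply: H.
    apply/allP => _ /mapP[j _ ->]; rewrite /root -pE IH ?(ltnW kd)// => i ki.
    rewrite addZ_delta; have [->|ik] := eqVneq i (Ordinal kd).
      by exists j; rewrite mulr1n addrCA subrr addr0.
    rewrite mulr0n addr0; apply: Hy; rewrite ltn_neqAle ki andbT.
    by apply: contra ik => /eqP ki'; apply/eqP/val_inj.
  rewrite map_inj_uniq ?enum_uniq// => a b /(congr1 (@complex.Re R)).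
  rewrite !linearZ /= !mulr1 => /addIr/eqP.
  by rewrite eqr_nat => /eqP/val_inj.
by rewrite -[y]addr0 -(scale0r (ee (Ordinal kd))) pE p0 horner0.
Qed.

(** The difference between [f] and its tensor Lagrange interpolant on the grid
    {0, ..., D}^d vanishes on that grid. *)
Lemma box_polynomial D f : line_polynomial D.+1 f ->
  exists b : {ffun 'I_d -> 'I_D.+1} -> C,
    forall x, f x = \sum_(alpha : {ffun 'I_d -> 'I_D.+1}) monomial x alpha *: b alpha.
Proof.
move=> fp; pose L j : {poly C} := tnth (D.+1.-lagrange (fun j => j%:R : C)) j.
have inj : injective (fun j : nat => j%:R : C).
  by move=> a b /eqP; rewrite eqr_nat => /eqP.
have sL j : size (L j) = D.+1 by exact: size_lagrange_.
pose g x := \sum_(alpha : {ffun 'I_d -> 'I_D.+1})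
  (\prod_i (L (alpha i)).[(x ord0 i)%:A]) * f (\row_i (alpha i)%:R).
have fg x : f x = g x.
  apply/eqP; rewrite -subr_eq0; apply/eqP; move: x.
  apply: (@grid_vanish D) => [x k|beta].
    have [p sp pE] := fp x (ee k).
    pose q (alpha : {ffun 'I_d -> 'I_D.+1}) : {poly C} :=
      ((\prod_(i | i != k) (L (alpha i)).[(x ord0 i)%:A]) *
        f (\row_i (alpha i)%:R)) *: (L (alpha k) \Po ('X + (x ord0 k)%:A%:P)).
    exists (p - \sum_alpha q alpha).
      rewrite (leq_trans (size_polyD _ _))// geq_max sp size_polyN.
      rewrite (leq_trans (size_sum _ _ _))//; apply/bigmax_leqP => a _.
      by rewrite (leq_trans (size_scale_leq _ _))// size_comp_poly2 ?size_XaddC// sL.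
    move=> s; rewrite hornerD hornerN pE horner_sum; congr (_ - _).
    apply: eq_bigr => a _; rewrite hornerZ horner_comp !hornerE (bigD1 k)//=.
    rewrite addZ_delta eqxx scalerDl [in X in _.[X]]addrC -mulrA mulrC;
      congr (_ * _ * _).
    by apply: eq_bigr => i /negPf ik; rewrite addZ_delta ik addr0.
  have delta a (b : 'I_D.+1) : (L a).[(b%:R : R)%:A] = (a == b)%:R.
    by rewrite natA; exact: lagrange_sample.
  apply/eqP; rewrite subr_eq0; apply/eqP.
  rewrite /g (bigD1 beta)//= [X in _ = _ + X]big1 => [|a ab].
    by rewrite addr0 big1 ?mul1r// => i _; rewrite mxE delta eqxx.
  have [i ai] : exists i, a i != beta i.
    apply/existsP; apply: contraNT ab; rewrite negb_exists => /forallP H.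
    by apply/eqP/ffunP => i; apply/eqP/negPn.
  by rewrite (bigD1 i)//= mxE delta (negPf ai) !mul0r.
exists (fun beta : {ffun 'I_d -> 'I_D.+1} => \sum_(alpha : {ffun 'I_d -> 'I_D.+1})
  (\prod_i (L (alpha i))`_(beta i)) * f (\row_i (alpha i)%:R)) => x.
rewrite fg; under [RHS]eq_bigr do rewrite scaler_sumr.
rewrite exchange_big; apply: eq_bigr => a _ /=.
under [RHS]eq_bigr do rewrite scalerAl.
rewrite -mulr_suml; congr (_ * _).
under eq_bigr => i _ do rewrite (@horner_coef_wide _ D.+1) ?sL//.
rewrite bigA_distr_bigA; apply: eq_bigr => b _ /=.
rewrite big_split /= mulrC -mulr_algl; congr (_ * _).
apply: etrans (esym (rmorph_prod (GRing.in_alg C) _ _ _)).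
by apply: eq_bigr => i _; rewrite (rmorphXn (GRing.in_alg C)).
Qed.

(** A multi-index in the box {0, ..., D}^d has length at most [d * D], which
    is why [N] is [(d * D).+1]. *)
Lemma polynomial_fun_box D (b : {ffun 'I_d -> 'I_D.+1} -> C) : (0 < d)%N ->
  exists (N : nat) (a : {ffun 'I_d -> 'I_N} -> C),
    forall x, \sum_(alpha : {ffun 'I_d -> 'I_D.+1}) monomial x alpha *: b alpha =
      polynomial_fun a x.
Proof.
move=> d0; have leN : (D.+1 <= (d * D).+1)%N by rewrite ltnS leq_pmull.
pose small (alpha : {ffun 'I_d -> 'I_(d * D).+1}) := [forall i, (alpha i < D.+1)%N].
pose shrink (alpha : {ffun 'I_d -> 'I_(d * D).+1}) : {ffun 'I_d -> 'I_D.+1} :=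
  [ffun i => inord (alpha i)].
pose grow (alpha : {ffun 'I_d -> 'I_D.+1}) : {ffun 'I_d -> 'I_(d * D).+1} :=
  [ffun i => widen_ord leN (alpha i)].
exists (d * D).+1, (fun alpha => if small alpha then b (shrink alpha) else 0).
move=> x; rewrite /polynomial_fun (bigID small)/= [X in _ + X]big1 ?addr0; last first.
  by move=> alpha /andP[_ /negPf->]; rewrite scaler0.
rewrite (reindex_onto grow shrink) => [|alpha /andP[_ /forallP sa]]; last first.
  by apply/ffunP => i; rewrite !ffunE; apply: val_inj; rewrite /= inordK.
apply: eq_big => [alpha|alpha _]; last first.
  have -> : small (grow alpha) by apply/forallP => i; rewrite ffunE /=.
  congr (_ *: b _); first by apply: eq_bigr => i _; rewrite ffunE.
  by apply/ffunP => i; rewrite !ffunE; apply: val_inj; rewrite /= inordK.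
apply/esym/andP; split; last first.
  by apply/eqP/ffunP => i; rewrite !ffunE; apply: val_inj; rewrite /= inordK.
apply/andP; split; last by apply/forallP => i; rewrite ffunE /=.
rewrite ltnS -[X in (_ <= X * _)%N](card_ord d) -sum_nat_const leq_sum// => i _.
by rewrite ffunE /= -ltnS.
Qed.

End lines.

(** On the real line the degree is read off from a single nonzero step [h k]:
    along [h k N] it is less than [m], and a polynomial is determined by its
    values there. *)
Lemma lattice_line_polynomial1 (R : realType) m ell (h : 'I_ell -> 'rV[R]_1)
    (f : 'rV[R]_1 -> Rcomplex R) :
  dense [set x | exists n : 'I_ell -> int, x = \sum_(k < ell) h k *~ n k] ->
  continuous f ->
  (forall k, iter m.+1 (difference (translate (h k))) f = 0) ->
  line_polynomial m.+1 f.
Proof.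
move=> hdense cf fD x v.
have [[k /eqP hk]|h0] := pselect (exists k, h k <> 0).
  have [c ->] : exists c, v = c *: h k.
    exists (v ord0 ord0 / h k ord0 ord0); apply/rowP => i; rewrite !ord1 !mxE divfK//.
    by apply: contra hk => /eqP h0; apply/eqP/rowP => j; rewrite !ord1 h0 mxE.
  have [r _ rE] := lattice_line_polynomial hdense cf fD x (h k).
  have [q sq qE] := @nat_polynomial_steps R 1 m [:: (h k, 1%N)] f x
     (fun p ps => ltac:(by move: ps; rewrite inE => /eqP-> /=; exact: fD)).
  have {}qE : r = q.
    apply: horner_natr_inj => n; rewrite -qE big_seq1 -natA -rE mulr1n.
    by rewrite scaler_nat.
  exists (q \Po (c%:A *: 'X)) => [|s].
    rewrite (leq_trans (size_comp_poly_leq _ _))//.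
    have := size_scale_leq (c%:A : Rcomplex R) 'X; rewrite size_polyX => sX.
    move: sq; rewrite /= mul1n; move: (size q) (size _) sX => u w; nia.
  by rewrite scalerA rE qE horner_comp hornerZ hornerX mulr_algl scalerA mulrC.
(* All steps are zero: the subgroup {0} is dense, and [f] is constant. *)
exists (f 0)%:P => [|s]; first by rewrite (leq_trans (size_polyC_leq1 _)).
rewrite hornerC; move: (x + _) => y; move: y.
apply: (@dense_eq R 'rV[R]_1 _ f (cst (f 0)) hdense) => //; first exact: cst_continuous.
move=> _ /set_mem[n ->]; rewrite big1// => k _.
suff -> : h k = 0 by rewrite mul0rz.
by apply: contrapT => hk; apply: h0; exists k.
Qed.

(** * Smooth real functions *)

Section linear_bridge.
Variables (R : realType) (V W : normedModType R).

Lemma is_derive_linear (U : normedModType R) (L : V -> W) (F : U -> V) x v :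
  linear L -> continuous L -> derivable F x v ->
  is_derive x v (L \o F) (L ('D_v F x)).
Proof.
move=> linL cL dF.
pose L' : {linear V -> W} := HB.pack L (GRing.isLinear.Build _ _ _ _ L linL).
have LF : (fun t : R => t^-1 *: (((L \o F) \o shift x) (t *: v) - (L \o F) x)) =
    L \o (fun t : R => t^-1 *: ((F \o shift x) (t *: v) - F x)).
  by apply/funext => t /=; rewrite -[L]/(L' : V -> W) -(raddfB L') -linearZ_LR.
have c : (fun t : R => t^-1 *: (((L \o F) \o shift x) (t *: v) - (L \o F) x))
    @ 0^' --> L ('D_v F x).
  by rewrite LF; apply: continuous_cvg => //; exact: cL.
by apply: DeriveDef; [apply/cvg_ex; exists (L ('D_v F x)) | exact: cvg_lim c].
Qed.

End linear_bridge.

Section mean_value.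
Variable R : realType.
Implicit Types (g dg : R -> R).

Lemma mean_value_bound g dg C t : (forall s : R, is_derive s 1 g (dg s)) ->
  (forall s, `|s| <= `|t| -> `|dg s| <= C) -> `|g t - g 0| <= C * `|t|.
Proof.
move=> dgP dgC.
have cg : continuous g.
  by move=> s; apply/differentiable_continuous/derivable1_diffP; case: (dgP s).
have [t0|t0] := leP 0 t.
  have [|c] := MVT_segment t0 (fun s _ => dgP s); first exact/continuous_subspaceT.
  rewrite in_itv/= subr0 => /andP[c0 ct] ->; rewrite normrM ler_wpM2r// dgC//.
  by rewrite !ger0_norm.
have [|c] := MVT_segment (ltW t0) (fun s _ => dgP s); first exact/continuous_subspaceT.
rewrite in_itv/= sub0r distrC => /andP[c0 ct] ->;
  rewrite normrM normrN ler_wpM2r// dgC//.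
by rewrite !ler0_norm ?lerN2// ltW.
Qed.

Lemma taylor1_bound g dg ddg C t : (forall s : R, is_derive s 1 g (dg s)) ->
  (forall s : R, is_derive s 1 dg (ddg s)) ->
  (forall s, `|s| <= `|t| -> `|ddg s| <= C) ->
  `|g t - g 0 - t * dg 0| <= C * `|t| ^+ 2.
Proof.
move=> dgP ddgP ddgC.
have dkP (s : R) : is_derive s 1 (fun s => g s - s * dg 0) (dg s - dg 0).
  apply: is_deriveB; rewrite -[X in is_derive _ _ _ X]mul1r.
  rewrite (_ : (fun _ => _) = (fun s => dg 0 *: s)); last by apply/funext => u;
    rewrite mulrC.
  by apply: is_derive_eq; rewrite scaler1 mul1r.
rewrite expr2 mulrA; have := mean_value_bound (C := C * `|t|) (t := t) dkP.
rewrite mul0r subr0 addrAC; apply => s st.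
apply: le_trans (mean_value_bound ddgP _) _ => [u us|]; last first.
  have C0 : 0 <= C by apply: le_trans (ddgC 0 _); rewrite ?normr0.
  exact: ler_wpM2l.
by apply: ddgC; exact: le_trans st.
Qed.

End mean_value.

Section smooth_real.
Variables (R : realType) (d : nat).
Local Notation E := 'rV[R]_d.
Local Notation ee i := (delta_mx ord0 i : E).
Implicit Types (f g : E -> R) (x y : E) (i j : 'I_d).

Definition pd i f : E -> R := fun x => 'D_(ee i) f x.
Definition pds s f : E -> R := foldr pd f s.

(** The real-valued analogue of [smooth]. *)
Definition rsmooth f := forall s : seq 'I_d,
  continuous (pds s f) /\ forall i x, derivable (pds s f) x (ee i).

Lemma rsmooth_continuous f : rsmooth f -> continuous f.
Proof. by move=> /(_ [::])[]. Qed.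

Lemma rsmooth_derivable f i x : rsmooth f -> derivable f x (ee i).
Proof. by move=> /(_ [::])[_]. Qed.

Lemma pds_cat s1 s2 f : pds (s1 ++ s2) f = pds s1 (pds s2 f).
Proof. by rewrite /pds foldr_cat. Qed.

Lemma rsmooth_pds s f : rsmooth f -> rsmooth (pds s f).
Proof. by move=> sf s'; rewrite -pds_cat. Qed.

Lemma rsmooth_pd i f : rsmooth f -> rsmooth (pd i f).
Proof. exact: (@rsmooth_pds [:: i]). Qed.

(** This avoids formulas for higher derivatives: smoothness is proved below by
    exhibiting a class of functions that is closed under differentiation. *)
Lemma rsmooth_coind (P : (E -> R) -> Prop) :
  (forall f, P f -> continuous f /\ forall i, (forall x, derivable f x (ee i)) /\
     P (pd i f)) ->
  forall f, P f -> rsmooth f.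
Proof.
move=> H f Pf s.
have {Pf} Ps : P (pds s f) by elim: s => //= i s /H[_ /(_ i)[]].
by have [cs ds] := H _ Ps; split=> // i x; have [] := ds i.
Qed.

Lemma line_is_derive f x i (s : R) : derivable f (x + s *: ee i) (ee i) ->
  is_derive s 1 (fun t : R => f (x + t *: ee i)) (pd i f (x + s *: ee i)).
Proof.
have e : (fun h : R => h^-1 *: (((fun t : R => f (x + t *: ee i)) \o shift s) (h *: 1)
     - f (x + s *: ee i))) =
   (fun h : R => h^-1 *: ((f \o shift (x + s *: ee i)) (h *: ee i) - f (x + s *:
     ee i))).
  apply/funext => h /=; congr (_ *: (f _ - _)).
  by rewrite -[h%:A]/(h * 1) mulr1 scalerDl addrCA.
by move=> df; apply: DeriveDef; rewrite /derivable /derive e.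
Qed.

Lemma rsmooth_line f x i (s : R) : rsmooth f ->
  is_derive s 1 (fun t : R => f (x + t *: ee i)) (pd i f (x + s *: ee i)).
Proof. by move=> sf; apply: line_is_derive; exact: rsmooth_derivable. Qed.

Lemma line_lipschitz f x i C (t : R) : rsmooth f ->
  (forall s : R, `|s| <= `|t| -> `|pd i f (x + s *: ee i)| <= C) ->
  `|f (x + t *: ee i) - f x| <= C * `|t|.
Proof.
move=> sf H; have := mean_value_bound (fun s : R => rsmooth_line x i s sf) H.
by rewrite scale0r addr0.
Qed.

Lemma line_taylor f x i C (t : R) : rsmooth f ->
  (forall s : R, `|s| <= `|t| -> `|pd i (pd i f) (x + s *: ee i)| <= C) ->
  `|f (x + t *: ee i) - f x - t * pd i f x| <= C * `|t| ^+ 2.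
Proof.
move=> sf H; have := taylor1_bound (fun s : R => rsmooth_line x i s sf)
  (fun s : R => rsmooth_line x i s (rsmooth_pd i sf)) H.
by rewrite scale0r addr0.
Qed.

Lemma rV_norm_le x r : 0 <= r -> (`|x| <= r) = [forall i, `|x ord0 i| <= r].
Proof.
move=> r0; apply/idP/forallP => [xr i|H].
  apply: le_trans xr; rewrite [leRHS]/Num.norm /= mx_normrE.
  by apply/bigmax_geP; right => /=; exists (ord0, i).
rewrite [leLHS]/Num.norm /= mx_normrE; apply/bigmax_leP; split=> // -[a i] _ /=.
by rewrite (ord1 a).
Qed.

Lemma rV_coord_le x i : `|x ord0 i| <= `|x|.
Proof. by have := rV_norm_le x (normr_ge0 x); rewrite lexx => /esym/forallP. Qed.

Lemma norm_scale_delta i (t : R) : `|t *: ee i| <= `|t|.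
Proof.
rewrite normrZ -[leRHS]mulr1; apply: ler_pM => //.
rewrite rV_norm_le ?ler01//; apply/forallP => k; rewrite mxE eqxx /=.
by case: (_ == _); rewrite ?normr1 ?normr0.
Qed.

(** Changing the coordinates one at a time stays in the ball, which is a cube. *)
Lemma ball_lipschitz f x y C : rsmooth f ->
  (forall i z, `|z - x| <= `|y - x| -> `|pd i f z| <= C) ->
  `|f y - f x| <= d%:R * C * `|y - x|.
Proof.
move=> sf H; pose z k : E := \row_i (if (i < k)%N then y ord0 i else x ord0 i).
have z0 : z 0%N = x by apply/rowP => i; rewrite mxE.
have zd : z d = y by apply/rowP => i; rewrite mxE ltn_ord.
suff: forall k, (k <= d)%N -> `|f (z k) - f x| <= k%:R * C * `|y - x|.
  by move=> /(_ d (leqnn d)); rewrite zd.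
elim=> [_|k IH kd]; first by rewrite z0 subrr normr0 !mul0r.
pose i := Ordinal kd; pose t := y ord0 i - x ord0 i.
have zS : z k.+1 = z k + t *: ee i.
  apply/rowP => j; rewrite addZ_delta !mxE ltnS leq_eqVlt -(inj_eq val_inj) /=.
  have [jk|] := eqVneq (nat_of_ord j) k; last by rewrite mulr0n addr0.
  rewrite jk ltnn mulr1n /= /t; have -> : j = i by exact/val_inj.
  by rewrite addrCA subrr addr0.
have tyx : `|t| <= `|y - x|.
  by apply: le_trans (rV_coord_le (y - x) i); rewrite !mxE.
rewrite -natr1 !mulrDl mul1r.
have -> : f (z k.+1) - f x = (f (z k) - f x) + (f (z k.+1) - f (z k)).
  by rewrite [RHS]addrC addrA subrK.
apply: (le_trans (ler_normD _ _)); apply: lerD; first exact/IH/ltnW.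
have C0 : 0 <= C by apply: le_trans (H i x _); rewrite ?subrr ?normr0.
apply: (@le_trans _ _ (C * `|t|)); last exact: ler_wpM2l.
rewrite zS; apply: line_lipschitz => // s st; apply: H.
rewrite rV_norm_le//; apply/forallP => j; rewrite mxE addZ_delta !mxE.
have [->|ji] := eqVneq j i; last first.
  rewrite mulr0n addr0; case: ifP => _; last by rewrite subrr normr0.
  by apply: le_trans (rV_coord_le (y - x) j); rewrite !mxE.
rewrite ltnn mulr1n addrAC subrr add0r; exact: le_trans tyx.
Qed.

(** The second difference of [f] in the directions [i] and [j] is symmetric
    in [i] and [j], and both mixed derivatives are its limits; this is the
    estimate, for one of the two orders. *)
Lemma second_difference_bound f x i j a e (t : R) : rsmooth f ->
  (forall s u : R, `|s| <= `|t| -> `|u| <= `|t| ->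
    `|pd i (pd j f) (x + s *: ee j + u *: ee i) - a| <= e) ->
  `|f (x + t *: ee j + t *: ee i) - f (x + t *: ee i) - f (x + t *: ee j) + f x
    - t ^+ 2 * a| <= e * `|t| ^+ 2.
Proof.
move=> sf H.
have lin (b s : R) : is_derive s 1 (fun s : R => s * b) b.
  rewrite (_ : (fun _ => _) = (fun s => b *: s)); last by apply/funext => u;
    rewrite mulrC.
  by apply: is_derive_eq; rewrite -[RHS]mulr1.
pose G (s : R) := f (x + t *: ee i + s *: ee j) - f (x + s *: ee j) - s * (t * a).
pose dG (s : R) := pd j f (x + t *: ee i + s *: ee j) - pd j f (x + s *: ee j) - t * a.
have GP (s : R) : is_derive s 1 G (dG s).
  by apply: is_deriveB; apply: is_deriveB; exact: rsmooth_line.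
have dGb (s : R) : `|s| <= `|t| -> `|dG s| <= e * `|t|.
  move=> st; pose K (u : R) := pd j f (x + s *: ee j + u *: ee i) - u * a.
  have KP (u : R) : is_derive u 1 K (pd i (pd j f) (x + s *: ee j + u *: ee i) - a).
    by apply: is_deriveB; apply: rsmooth_line; exact: rsmooth_pd.
  have := mean_value_bound KP (fun u => H s u st).
  rewrite /K /dG mul0r subr0 scale0r addr0 addrAC [x + t *: _ + _]addrAC.
  by rewrite addrAC.
have := mean_value_bound GP dGb.
rewrite /G mul0r subr0 !scale0r !addr0 expr2 mulrA -[_ * _ * `|t|]mulrA -expr2.
rewrite [x + t *: ee i + _]addrAC; congr (`|_| <= _); ring.
Qed.

Lemma continuous_ball_le f x e : 0 < e -> continuous f ->
  exists2 r : R, 0 < r & forall y, `|y - x| < r -> `|f y - f x| <= e.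
Proof.
move=> e0 cf.
have /nbhs_ballP[r /= r0 rP] : \forall y \near x, `|f x - f y| <= e.
  by apply: (cvgr_dist_le (F := nbhs x)) => //; exact: cf.
exists r => // y yx; rewrite distrC; apply: rP.
by rewrite -ball_normE /= distrC.
Qed.

Lemma pd_comm f i j : rsmooth f -> pd i (pd j f) = pd j (pd i f).
Proof.
move=> sf; apply/funext => x; apply/eqP; rewrite -subr_eq0 -normr_eq0.
rewrite eq_le normr_ge0 andbT; apply/ler_addgt0Pl => e e0; rewrite addr0.
set a := pd i (pd j f) x; set b := pd j (pd i f) x.
have ca : continuous (pd i (pd j f)) by exact/rsmooth_continuous/rsmooth_pd/rsmooth_pd.
have cb : continuous (pd j (pd i f)) by exact/rsmooth_continuous/rsmooth_pd/rsmooth_pd.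
have e2 : 0 < e / 2 by rewrite divr_gt0.
have [r1 r10 r1P] := continuous_ball_le x e2 ca.
have [r2 r20 r2P] := continuous_ball_le x e2 cb.
pose r := Num.min r1 r2; have r0 : 0 < r by rewrite lt_min r10.
have rr1 : r <= r1 by rewrite ge_min lexx.
have rr2 : r <= r2 by rewrite ge_min lexx orbT.
pose t := r / 4; have t0 : 0 < t by rewrite divr_gt0.
have small k l (s u : R) : `|s| <= `|t| -> `|u| <= `|t| ->
    `|x + s *: ee k + u *: ee l - x| < r.
  move=> st ut; apply: (@le_lt_trans _ _ (t + t)); last by rewrite /t; lra.
  rewrite rV_norm_le ?addr_ge0 ?ltW//; apply/forallP => m.
  rewrite -(addrA x) (addrC x) addrK !mxE eqxx /=.
  apply: le_trans (ler_normD _ _) _; rewrite (gtr0_norm t0) in st ut.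
  by apply: lerD; case: (_ == _); rewrite ?mulr1 ?mulr0 ?normr0// ltW.
have := second_difference_bound sf (fun s u st ut =>
  r1P _ (lt_le_trans (small j i s u st ut) rr1)).
have := second_difference_bound sf (fun s u st ut =>
  r2P _ (lt_le_trans (small i j s u st ut) rr2)).
rewrite -/a -/b; clearbody a b.
rewrite [x + t *: ee i + _]addrAC (gtr0_norm t0) =>
  /ler_normlP[h1 h2] /ler_normlP[h3 h4].
have t2 : 0 < t ^+ 2 by rewrite exprn_gt0.
rewrite -(ler_pM2l t2) -[X in X * `|_|]gtr0_norm// -normrM ler_norml.
by apply/andP; split; lra.
Qed.

Lemma is_derive_pd f i x : rsmooth f -> is_derive x (ee i) f (pd i f x).
Proof. by move=> sf; apply: DeriveDef => //; exact: rsmooth_derivable. Qed.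

(** By Leibniz's rule this class is closed under partial differentiation, so
    [rsmooth_coind] applies to it. *)
Inductive smooth_algebra : (E -> R) -> Prop :=
| smooth_algebra_in f : rsmooth f -> smooth_algebra f
| smooth_algebra_add f g : smooth_algebra f -> smooth_algebra g ->
    smooth_algebra (fun x => f x + g x)
| smooth_algebra_mul f g : smooth_algebra f -> smooth_algebra g ->
    smooth_algebra (fun x => f x * g x).

Lemma rsmooth_algebra f : smooth_algebra f -> rsmooth f.
Proof.
move: f; apply: rsmooth_coind => f.
elim=> {f} [f sf|f g sf [cf df] sg [cg dg]|f g sf [cf df] sg [cg dg]].
- split; first exact: rsmooth_continuous.
  move=> i; split; first by move=> x; exact: rsmooth_derivable.
  exact/smooth_algebra_in/rsmooth_pd.
- split=> [x|i]; first exact: cvgD (cf x) (cg x).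
  have D x : is_derive x (ee i) (fun x => f x + g x) (pd i f x + pd i g x).
    have [dfi _] := df i; have [dgi _] := dg i.
    by apply: is_deriveD; exact: derivableP.
  split=> [x|]; first by case: (D x).
  rewrite (_ : pd i _ = fun x => pd i f x + pd i g x).
    by apply: smooth_algebra_add; [case: (df i)|case: (dg i)].
  by apply/funext => x; have [_] := D x.
- split=> [x|i]; first exact: cvgM (cf x) (cg x).
  have D x : is_derive x (ee i) (fun x => f x * g x) (f x * pd i g x + g x * pd i f x).
    have [dfi _] := df i; have [dgi _] := dg i.
    have := @is_deriveM _ _ f g x (ee i) _ _ (derivableP (dfi x)) (derivableP (dgi x)).
    by [].
  split=> [x|]; first by case: (D x).
  rewrite (_ : pd i _ = fun x => f x * pd i g x + g x * pd i f x).
    by apply: smooth_algebra_add; apply: smooth_algebra_mul => //;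
      [case: (dg i)|case: (df i)].
  by apply/funext => x; have [_] := D x.
Qed.

Lemma rsmoothD f g : rsmooth f -> rsmooth g -> rsmooth (fun x => f x + g x).
Proof. by move=> sf sg; apply/rsmooth_algebra/smooth_algebra_add;
  exact: smooth_algebra_in. Qed.

Lemma rsmoothM f g : rsmooth f -> rsmooth g -> rsmooth (fun x => f x * g x).
Proof. by move=> sf sg; apply/rsmooth_algebra/smooth_algebra_mul;
  exact: smooth_algebra_in. Qed.

Lemma pd_cst i (c : R) : pd i (fun=> c) = fun=> 0.
Proof. by apply/funext => x;
  exact: (@derive_val _ _ _ _ _ _ _ (is_derive_cst c x (ee i))). Qed.

Lemma rsmooth_cst (c : R) : rsmooth (fun=> c).
Proof.
apply: (rsmooth_coind (P := fun f => exists c, f = fun=> c)); last by exists c.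
move=> _ [a ->]; split; first exact: cst_continuous.
move=> i; split=> [x|]; last by exists 0; rewrite pd_cst.
exact: (@ex_derive _ _ _ _ _ _ _ (is_derive_cst a x (ee i))).
Qed.

Lemma rsmoothZ (c : R) f : rsmooth f -> rsmooth (fun x => c * f x).
Proof. by apply: rsmoothM; exact: rsmooth_cst. Qed.

Lemma pdD i f g : rsmooth f -> rsmooth g ->
  pd i (fun x => f x + g x) = fun x => pd i f x + pd i g x.
Proof.
move=> sf sg; apply/funext => x; apply: (@derive_val _ _ _ x (ee i)).
by apply: is_deriveD; exact: is_derive_pd.
Qed.

Lemma pdM i f g : rsmooth f -> rsmooth g ->
  pd i (fun x => f x * g x) = fun x => f x * pd i g x + g x * pd i f x.
Proof.
move=> sf sg; apply/funext => x; apply: (@derive_val _ _ _ x (ee i)).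
exact: (@is_deriveM _ _ f g x (ee i) _ _ (is_derive_pd i x sf) (is_derive_pd i x sg)).
Qed.

Lemma pdZ i (c : R) f : rsmooth f -> pd i (fun x => c * f x) = fun x => c * pd i f x.
Proof.
move=> sf; rewrite (pdM i (rsmooth_cst c) sf) pd_cst.
by apply/funext => x; rewrite mulr0 addr0.
Qed.

Lemma pdsD s f g : rsmooth f -> rsmooth g ->
  pds s (fun x => f x + g x) = fun x => pds s f x + pds s g x.
Proof.
move=> sf sg; elim: s => [//|i s IH]; rewrite [LHS]/= IH.
by apply: pdD; exact: rsmooth_pds.
Qed.

Lemma pdsZ s (c : R) f : rsmooth f -> pds s (fun x => c * f x) = fun x => c * pds s f x.
Proof.
move=> sf; elim: s => [//|i s IH]; rewrite [LHS]/= IH.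
exact/pdZ/rsmooth_pds.
Qed.

Definition line_invariant i f := forall x (t : R), f (x + t *: ee i) = f x.

Lemma pd_line_invariant i f : line_invariant i f -> pd i f = fun=> 0.
Proof.
move=> If; apply/funext => x; apply: (@derive_val _ _ _ x (ee i)).
have e : (fun h : R => h^-1 *: ((f \o shift x) (h *: ee i) - f x)) = fun=> 0.
  by apply/funext => h /=; rewrite (addrC _ x) If subrr scaler0.
apply: DeriveDef; rewrite /derivable /derive e; first exact: is_cvg_cst.
exact: lim_cst.
Qed.

Lemma iter_pdM_line_invariant n i g f : rsmooth g -> rsmooth f ->
  line_invariant i g ->
  iter n (pd i) (fun x => g x * f x) = fun x => g x * iter n (pd i) f x.
Proof.
move=> sg sf Ig; have sn m : rsmooth (iter m (pd i) f).
  by elim: m => [|m IH]; [exact: sf|exact: rsmooth_pd].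
elim: n => [//|n IH]; rewrite [LHS]iterS IH (pdM i sg (sn n)) (pd_line_invariant Ig).
by apply/funext => x; rewrite mulr0 addr0.
Qed.

Lemma rsmooth_coord i : rsmooth (fun x => x ord0 i).
Proof.
have D j x : is_derive x (ee j) (fun y : E => y ord0 i : R) ((i == j)%:R : R).
  have e : (fun h : R => h^-1 *: (((fun x : E => x ord0 i) \o shift x) (h *: ee j)
     - x ord0 i)) @ 0^' --> ((i == j)%:R : R).
    apply: cvg_near_cst.
    near=> h; rewrite /= (addrC _ x) addZ_delta (addrC (x _ _)) addrK.
    have h0 : h != 0 by near: h; exact: nbhs_dnbhs_neq.
    by rewrite /GRing.scale /= -mulr_natr mulrA mulVf// mul1r.
  by apply: DeriveDef; [apply/cvg_ex; exists ((i == j)%:R : R)|exact: cvg_lim e].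
apply: (rsmooth_coind (P := fun f => (f = fun x => x ord0 i) \/ rsmooth f));
  last by left.
move=> f [->|sf]; last first.
  split; first exact: rsmooth_continuous.
  by move=> j; split=> [x|]; [exact: rsmooth_derivable|right; exact: rsmooth_pd].
split; first exact: coord_continuous.
move=> j; split=> [x|]; first by case: (D j x).
right; rewrite (_ : pd j _ = fun=> (i == j)%:R); first exact: rsmooth_cst.
by apply/funext => x; have [_] := D j x.
Unshelve. all: by end_near. Qed.

Lemma rsmoothX f n : rsmooth f -> rsmooth (fun x => f x ^+ n).
Proof.
move=> sf; elim: n => [|n IH]; first exact: (rsmooth_cst 1).
rewrite (_ : (fun _ => _) = fun x => f x * f x ^+ n); first exact: rsmoothM.
by apply/funext => x; rewrite exprS.
Qed.

Lemma rsmooth_prod (I : Type) (r : seq I) (P : pred I) (F : I -> E -> R) :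
  (forall k, rsmooth (F k)) -> rsmooth (fun x => \prod_(k <- r | P k) F k x).
Proof.
move=> sF; elim: r => [|k r IH].
  rewrite (_ : (fun _ => _) = fun=> 1); first exact: rsmooth_cst.
  by apply/funext => x; rewrite big_nil.
rewrite (_ : (fun _ => _) = fun x => (if P k then F k x else 1) *
   \prod_(k <- r | P k) F k x).
  by apply: rsmoothM IH; case: (P k); [exact: sF|exact: rsmooth_cst].
by apply/funext => x; rewrite big_cons; case: (P k); rewrite ?mul1r.
Qed.

Lemma pds_shift s h f : pds s (fun x => f (x + h)) = fun x => pds s f (x + h).
Proof.
elim: s => //= i s ->; apply/funext => x; rewrite /pd /derive.
by under eq_fun do rewrite /= -addrA.
Qed.

Lemma rsmooth_shift h f : rsmooth f -> rsmooth (fun x => f (x + h)).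
Proof.
move=> sf s; rewrite pds_shift; have [cf df] := sf s; split=> [x|i x].
  apply: (continuous_comp (f := fun y => y + h)); last exact: cf.
  exact: (cvgD (F := nbhs x) cvg_id (cvg_cst _)).
have := df i (x + h); rewrite /derivable.
by under [in X in _ -> X]eq_fun do rewrite /= -addrA.
Qed.

Lemma continuous_bounded_ball f x r : continuous f ->
  exists2 C, 0 <= C & forall y, `|y - x| <= r -> `|f y| <= C.
Proof.
move=> cf; have K : compact (closed_ball_ (fun z : E => `|z|) x r).
  apply: bounded_closed_compact; last exact: closed_closed_ball_.
  exists (`|x| + r); split; first exact: num_real.
  move=> M xM y /= yx; rewrite -[y](subrK x) (le_trans (ler_normD _ _))//.
  by rewrite addrC (le_trans _ (ltW xM))// lerD2l distrC.
have /compact_bounded[M [_ HM]] : compact (f @` closed_ball_ (fun z : E => `|z|) x r).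
  by apply: continuous_compact => //; exact: continuous_subspaceT.
exists (`|M| + 1); first exact: addr_ge0.
move=> y yx; apply: HM; first by rewrite (le_lt_trans (ler_norm M))// ltrDl.
by exists y => //; rewrite /closed_ball_ /= distrC.
Qed.

End smooth_real.

(** * Integration along coordinate lines *)

Section line_integrals.
Variable R : realType.
Local Notation mu := (@lebesgue_measure R).
Implicit Types (g G : R -> R) (D : set (measurableTypeR R)) (K C : R).

(** An explicit radius is easier to propagate through estimates than the
    compactness of the support. *)
Definition supported K g := forall s, K < `|s| -> g s = 0.

Lemma supported_restrict K g : supported K g -> g \_ `[- K, K] = g.
Proof.
move=> gK; apply/funext => s; rewrite patchE; case: ifPn => //.
rewrite notin_setE /= in_itv /= -ler_norml => /negP; rewrite -ltNge => /gK ->.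
by [].
Qed.

Lemma integrable_supported K g D : continuous g -> supported K g ->
  measurable D -> mu.-integrable D (EFin \o g).
Proof.
move=> cg gK mD; apply: (@integrableS _ _ _ mu setT) => //.
have mI : measurable (`[- K, K]%classic : set (measurableTypeR R)) by exact:
  measurable_itv.
have -> : EFin \o g = (EFin \o g) \_ `[- K, K].
  by rewrite restrict_EFin supported_restrict.
apply: (@integrable_mkcond _ _ R mu _ (EFin \o g) mI).1.
apply: continuous_compact_integrable; first exact: segment_compact.
exact: continuous_subspaceT.
Qed.

Lemma Rintegral_supported K g D : supported K g ->
  \int[mu]_(s in D) g s = \int[mu]_(s in D `&` `[- K, K]) g s.
Proof. by move=> gK; rewrite Rintegral_mkcondr supported_restrict. Qed.

Lemma Rintegral_supported_bound K C g D : 0 <= K -> 0 <= C ->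
  continuous g -> supported K g -> measurable D -> (forall s, `|g s| <= C) ->
  `|\int[mu]_(s in D) g s| <= C * (2 * K).
Proof.
move=> K0 C0 cg gK mD gC; rewrite (Rintegral_supported D gK).
pose I : set (measurableTypeR R) := `[- K, K]%classic; rewrite -/I.
have mI : measurable I by exact: measurable_itv.
have mDI : measurable (D `&` I) by exact: measurableI.
have muI : mu I = (2 * K)%:E.
  by rewrite /I lebesgue_measure_itv /= lte_fin; case: ltP => ?; rewrite -?EFinB;
    congr (_%:E); lra.
have muDI : (mu (D `&` I) <= (2 * K)%:E)%E.
  by rewrite -muI le_measure ?inE//; exact: subIsetr.
have ig := integrable_supported cg gK mDI.
apply: (le_trans (le_normr_Rintegral mDI ig)).
apply: (@le_trans _ _ (\int[mu]_(s in D `&` I) C)).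
  apply: le_Rintegral => //.
    by rewrite (_ : EFin \o _ = abse \o (EFin \o g))//; exact: integrable_abse.
  apply: (measurable_bounded_integrable (f := cst C)) => //; last exact: bounded_cst.
  by rewrite (le_lt_trans muDI)// ltry.
rewrite Rintegral_cst// ler_wpM2l// -lee_fin fineK//.
by rewrite ge0_fin_numE ?measure_ge0// (le_lt_trans muDI)// ltry.
Qed.

Lemma FTC_supported K g G : continuous g -> supported K g -> supported K G ->
  (forall s : R, is_derive s 1 G (g s)) ->
  \int[mu]_s g s = 0 /\ \int[mu]_(s in `]-oo, 0]) g s = G 0.
Proof.
move=> cg gK GK dG; pose L := `|K| + 1.
have KL : K < L by rewrite /L (le_lt_trans (ler_norm K))// ltrDl.
have L0 : 0 < L by rewrite /L ltr_wpDl.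
have gL : supported L g by move=> s sL; apply: gK; exact: lt_trans sL.
have GL s : L <= `|s| -> G s = 0 by move=> sL; apply: GK; exact: lt_le_trans sL.
have cG : continuous G.
  by move=> s; apply/differentiable_continuous/derivable1_diffP; case: (dG s).
clearbody L.
have GL0 : G L = 0 by apply: GL; rewrite ger0_norm// ltW.
have GNL : G (- L) = 0 by apply: GL; rewrite normrN ger0_norm// ltW.
have ftc b : - L < b -> \int[mu]_(s in `[- L, b]) g s = G b.
  move=> Lb; rewrite /Rintegral (@continuous_FTC2 _ g G)//.
  - by rewrite GNL -EFinB /= subr0.
  - exact: continuous_subspaceT.
  - split=> [s _||].
    + by case: (dG s).
    + exact/cvg_at_right_filter/cG.
    + exact/cvg_at_left_filter/cG.
  - by move=> s _; rewrite derive1E; case: (dG s).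
split; rewrite (Rintegral_supported _ gL).
  by rewrite setTI ftc//; lra.
rewrite (_ : _ `&` _ = `[- L, 0]%classic) ?ftc ?oppr_lt0//.
apply/seteqP; split=> s /=; rewrite !in_itv /=; first by move=> [-> /andP[->]].
by move=> /andP[sL s0]; rewrite s0 sL; split => //=; lra.
Qed.

End line_integrals.

Section local_bounds.
Variable R : realType.

Lemma is_derive_quadratic (V W : normedModType R) (f : V -> W) x v a (C : R) :
  (forall t : R, `|t| <= 1 -> `|f (x + t *: v) - f x - t *: a| <= C * `|t| ^+ 2) ->
  is_derive x v f a.
Proof.
move=> H; have C0 : 0 <= C.
  by apply: le_trans (le_trans (normr_ge0 _) (H 1 _)) _; rewrite normr1 ?expr1n ?mulr1.
have c : (fun h : R => h^-1 *: ((f \o shift x) (h *: v) - f x)) @ 0^' --> a.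
  apply/cvgrPdist_le => e e0; near=> t.
  have t0 : t != 0 by near: t; exact: nbhs_dnbhs_neq.
  rewrite /= (addrC _ x) distrC.
  rewrite (_ : _ - a = t^-1 *: (f (x + t *: v) - f x - t *: a)); last first.
    by rewrite [RHS]scalerBr scalerA mulVf// scale1r.
  rewrite normrZ normfV ler_pdivrMl ?normr_gt0//.
  apply: le_trans (H _ _) _; first by near: t; apply: dnbhs0_le; exact: ltr01.
  rewrite expr2 mulrCA ler_wpM2l//.
  apply: (@le_trans _ _ ((C + 1) * `|t|)); first by rewrite ler_wpM2r// lerDl.
  rewrite -ler_pdivlMl ?ltr_wpDl// mulrC.
  by near: t; apply: dnbhs0_le; rewrite divr_gt0// ltr_wpDl.
by apply: DeriveDef; [apply/cvg_ex; exists a|exact: cvg_lim c].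
Unshelve. all: by end_near. Qed.

Lemma continuous_lipschitz (V W : normedModType R) (f : V -> W) x (C : R) :
  (forall y, `|y - x| <= 1 -> `|f y - f x| <= C * `|y - x|) -> {for x, continuous f}.
Proof.
move=> H; apply/(cvgrPdist_le (F := nbhs x)) => e e0.
have C1 : 0 < `|C| + 1 by rewrite ltr_wpDl.
near=> y; rewrite distrC.
have y1 : `|y - x| <= Num.min 1 (e / (`|C| + 1)).
  rewrite distrC; near: y; apply: (cvgr_dist_le (F := nbhs x)) => //.
  by rewrite lt_min ltr01 divr_gt0.
move: y1; rewrite le_min => /andP[y1 ye].
apply: le_trans (H y y1) _; apply: (@le_trans _ _ ((`|C| + 1) * `|y - x|)).
  by rewrite ler_wpM2r// (le_trans (ler_norm C))// lerDl.
by rewrite -ler_pdivlMl// mulrC.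
Unshelve. all: by end_near. Qed.

End local_bounds.

Section line_operators.
Variables (R : realType) (d : nat).
Local Notation E := 'rV[R]_d.
Local Notation ee i := (delta_mx ord0 i : E).
Local Notation mu := (@lebesgue_measure R).
Implicit Types (f g : E -> R) (x y : E) (i j : 'I_d) (D :
  set (measurableTypeR R)) (r : R).

Definition line_supported i r f := forall x, r < `|x ord0 i| -> f x = 0.

Lemma pd_near0 i f x : (\forall y \near x, f y = 0) -> pd i f x = 0.
Proof.
move=> f0; rewrite -(congr1 (fun g => g x) (pd_cst i 0)).
exact: near_eq_derive.
Qed.

Lemma line_supported_pd i j r f : line_supported i r f -> line_supported i r (pd j f).
Proof.
move=> fr x xr; apply: pd_near0.
apply/nbhs_ballP; exists (`|x ord0 i| - r) => /=; first by rewrite subr_gt0.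
move=> y; rewrite -ball_normE /= => xy; apply: fr.
have := le_lt_trans (rV_coord_le (x - y) i) xy; rewrite !mxE => h.
have := ler_distD 0 (x ord0 i) (y ord0 i).
have := lerB_dist (x ord0 i) (y ord0 i); lra.
Qed.

Lemma line_supported_le i r1 r2 f : r1 <= r2 -> line_supported i r1 f ->
  line_supported i r2 f.
Proof. by move=> r12 fr x xr; apply: fr; exact: le_lt_trans xr. Qed.

(** Integration in the [i]-th coordinate, for two domains: the whole line gives
    the total [line_total], the half-line up to [0] gives the primitive
    [primitive] that vanishes far to the left. *)
Definition int_line D i f : E -> R := fun x => \int[mu]_(s in D) f (x + s *: ee i).

Lemma supported_line i r f x : line_supported i r f ->
  supported (r + `|x ord0 i|) (fun s => f (x + s *: ee i)).
Proof.
move=> fr s rs; apply: fr; rewrite addZ_delta eqxx mulr1n addrC.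
by have := ler_normB (s + x ord0 i) (x ord0 i); rewrite addrK; lra.
Qed.

Lemma continuous_line i f x : continuous f -> continuous (fun s : R =>
  f (x + s *: ee i)).
Proof.
move=> cf s; apply: (continuous_comp (f := fun s : R => x + s *: ee i)); last exact: cf.
apply: (cvgD (F := nbhs s)); first exact: cvg_cst.
exact: (cvgZ (F := nbhs s)) cvg_id (cvg_cst _).
Qed.

Lemma integrable_line D i r f x : continuous f -> line_supported i r f ->
  measurable D ->
  mu.-integrable D (EFin \o (fun s => f (x + s *: ee i))).
Proof.
move=> cf fr mD; apply: integrable_supported mD; first exact: continuous_line.
exact: supported_line fr.
Qed.

Lemma norm_shift_le x y i (s K : R) : `|s| <= K -> `|y - x| <= 1 ->
  `|y + s *: ee i - x| <= K + 1.
Proof.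
move=> sK yx; rewrite addrAC; apply: le_trans (ler_normD _ _) _.
suff : `|s *: ee i| <= K by move: yx; lra.
exact: le_trans (norm_scale_delta i s) sK.
Qed.

Lemma pd_bounded_ball f x r : rsmooth f ->
  exists2 C, 0 <= C & forall i y, `|y - x| <= r -> `|pd i f y| <= C.
Proof.
move=> sf; have /choice[C CP] : forall i, exists C, 0 <= C /\
    forall y, `|y - x| <= r -> `|pd i f y| <= C.
  move=> i; have cf := rsmooth_continuous (rsmooth_pd i sf).
  by have [C C0 HC] := continuous_bounded_ball x r cf; exists C.
exists (\sum_i C i); first by apply: sumr_ge0 => i _; case: (CP i).
move=> i y yr; apply: le_trans (proj2 (CP i) y yr) _.
by rewrite (bigD1 i)//= lerDl sumr_ge0// => j _; case: (CP j).
Qed.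

Lemma continuous_int_line D i r f : measurable D -> rsmooth f -> line_supported i r f ->
  continuous (int_line D i f).
Proof.
move=> mD sf fr x; have cf := rsmooth_continuous sf.
pose K := `|r| + `|x ord0 i| + 1.
have [C C0 HC] := pd_bounded_ball x (K + 1) sf.
have K0 : 0 <= K by rewrite !addr_ge0.
apply: (continuous_lipschitz (C := d%:R * C * (2 * K))) => y yx.
have yxi : `|y ord0 i| <= `|x ord0 i| + 1.
  have := rV_coord_le (y - x) i; rewrite !mxE => h.
  by have := lerB_dist (y ord0 i) (x ord0 i); lra.
rewrite /int_line -RintegralB//; [|exact: integrable_line fr mD..].
apply: le_trans (@Rintegral_supported_bound _ K (d%:R * C * `|y - x|) _ _ K0 _ _ _
  mD _) _.
- by rewrite !mulr_ge0.
- by move=> s; apply: (cvgB (F := nbhs s)); exact: continuous_line.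
- move=> s Ks; rewrite !(supported_line fr) ?subrr//; apply: le_lt_trans Ks; rewrite /K.
    by have := ler_norm r; lra.
  by have := ler_norm r; lra.
- move=> s; have [sK|sK] := leP `|s| K; last first.
    rewrite !(supported_line fr) ?subrr ?normr0 ?mulr_ge0//; apply: le_lt_trans sK;
      rewrite /K.
      by have := ler_norm r; lra.
    by have := ler_norm r; lra.
  have -> : y - x = (y + s *: ee i) - (x + s *:
    ee i) by rewrite opprD addrACA subrr addr0.
  apply: ball_lipschitz => // j z.
  have -> : (y + s *: ee i) - (x + s *: ee i) =
    y - x by rewrite opprD addrACA subrr addr0.
  move=> zz; apply: HC; rewrite -[z](subrK (s *: ee i)); apply: norm_shift_le => //.
  have -> : z - s *: ee i - x = z - (x + s *: ee i) by rewrite opprD addrA addrAC.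
  exact: le_trans zz yx.
- by rewrite le_eqVlt; apply/orP; left; apply/eqP; ring.
Qed.

(** The integrand is nonzero only on a bounded part of the line, locally
    uniformly in [x], and there the remainder of its first-order Taylor expansion
    is uniformly quadratic; integrating keeps it quadratic. *)
Lemma is_derive_int_line D i j r f x : measurable D -> rsmooth f ->
  line_supported i r f ->
  is_derive x (ee j) (int_line D i f) (int_line D i (pd j f) x).
Proof.
move=> mD sf fr; have cf := rsmooth_continuous sf.
have sdf := rsmooth_pd j sf; have cdf := rsmooth_continuous sdf.
have dfr := line_supported_pd j fr.
pose K := `|r| + `|x ord0 i| + 1.
have K0 : 0 <= K by rewrite !addr_ge0.
have [C C0 HC] := continuous_bounded_ball x (K + 1)
  (rsmooth_continuous (rsmooth_pd j sdf)).
apply: (is_derive_quadratic (C := C * (2 * K))) => t t1.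
pose z (s : R) := x + s *: ee i.
have zt s : x + t *: ee j + s *: ee i = z s + t *: ee j by rewrite /z addrAC.
have xtj : `|(x + t *: ee j) ord0 i| <= `|x ord0 i| + 1.
  rewrite addZ_delta; apply: le_trans (ler_normD _ _) _; rewrite lerD2l.
  by case: (_ == _); rewrite ?mulr1n ?mulr0n ?normr0.
pose F1 (s : R) := f (x + t *: ee j + s *: ee i).
pose F2 (s : R) := f (x + s *: ee i).
pose F3 (s : R) := pd j f (x + s *: ee i).
have i1 : mu.-integrable D (EFin \o F1) by exact: integrable_line fr mD.
have i2 : mu.-integrable D (EFin \o F2) by exact: integrable_line fr mD.
have i3 : mu.-integrable D (EFin \o F3) by exact: integrable_line dfr mD.
have i4 : mu.-integrable D (EFin \o (fun s =>
  t * F3 s)) by exact: (integrableZl mD t i3).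
have i5 : mu.-integrable D (EFin \o (fun s =>
  F1 s - F2 s)) by exact: (integrableB mD i1 i2).
rewrite /int_line -[X in _ - X]/(t * _) -RintegralZl// -RintegralB// -RintegralB//.
apply: le_trans (@Rintegral_supported_bound _ K (C * `|t| ^+ 2) _ _ K0 _ _ _ mD _) _.
- by rewrite mulr_ge0// exprn_ge0.
- move=> s; apply: (cvgB (F := nbhs s)).
    apply: (cvgB (F := nbhs s)); exact: continuous_line.
  by apply: (cvgM (F := nbhs s)); [exact: cvg_cst|exact: continuous_line].
- move=> s Ks; rewrite !(supported_line fr) ?(supported_line dfr) ?subr0 ?mulr0
    ?subr0//;
    apply: le_lt_trans Ks; rewrite /K; have := ler_norm r; lra.
- move=> s; have [sK|sK] := leP `|s| K; last first.
    rewrite !(supported_line fr) ?(supported_line dfr) ?subr0 ?mulr0 ?subr0 ?normr0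
      ?mulr_ge0 ?exprn_ge0//;
      apply: le_lt_trans sK; rewrite /K; have := ler_norm r; lra.
  rewrite zt -/(z s); apply: line_taylor sf _ => u ut; apply: HC.
  have -> : z s + u *: ee j = x + u *: ee j + s *: ee i by rewrite /z addrAC.
  apply: (norm_shift_le _ sK); rewrite (addrC x) addrK.
  exact: le_trans (norm_scale_delta j u) (le_trans ut t1).
- by rewrite le_eqVlt; apply/orP; left; apply/eqP; ring.
Qed.

(** Integration along a line commutes with every partial derivative, hence
    preserves smoothness. *)
Lemma rsmooth_int_line D i r f : measurable D -> rsmooth f -> line_supported i r f ->
  rsmooth (int_line D i f).
Proof.
move=> mD sf fr; apply: (rsmooth_coind (P := fun F => exists g,
  [/\ rsmooth g, line_supported i r g & F = int_line D i g])); last by exists f.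
move=> _ [g [sg gr ->]]; split; first exact: continuous_int_line mD sg gr.
move=> j; split=> [x|]; first by case: (is_derive_int_line j x mD sg gr).
exists (pd j g); split; [exact: rsmooth_pd|exact: line_supported_pd|].
by apply/funext => x; have [_] := is_derive_int_line j x mD sg gr.
Qed.

Lemma pd_int_line D i j r f : measurable D -> rsmooth f -> line_supported i r f ->
  pd j (int_line D i f) = int_line D i (pd j f).
Proof.
by move=> mD sf fr; apply/funext => x; have [_] := is_derive_int_line j x mD sf fr.
Qed.

Lemma FTC_line i r f x : rsmooth f -> line_supported i r f ->
  \int[mu]_s pd i f (x + s *: ee i) = 0 /\
  \int[mu]_(s in `]-oo, 0]) pd i f (x + s *: ee i) = f x.
Proof.
move=> sf fr; have dfr := line_supported_pd i fr.
have [] := @FTC_supported _ (r + `|x ord0 i|) (fun s => pd i f (x + s *: ee i))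
  (fun s => f (x + s *: ee i)).
- exact/continuous_line/rsmooth_continuous/rsmooth_pd.
- exact: supported_line dfr.
- exact: supported_line fr.
- by move=> s; exact: rsmooth_line.
by move=> -> ->; rewrite scale0r addr0.
Qed.

Definition line_total i := int_line setT i.
Definition primitive i := int_line `]-oo, 0]%classic i.

(** The derivative of the total along its own line is the total of a
    derivative, hence zero. *)
Lemma line_total_invariant i r f : rsmooth f -> line_supported i r f ->
  line_invariant i (line_total i f).
Proof.
move=> sf fr x t; apply/eqP; rewrite -subr_eq0 -normr_le0.
have sI : rsmooth (line_total i f) by exact: rsmooth_int_line measurableT sf fr.
rewrite -[leRHS](mul0r `|t|); apply: (line_lipschitz sI) => s _.
rewrite (pd_int_line i measurableT sf fr) /int_line.
by have [-> _] := FTC_line (x + s *: ee i) sf fr; rewrite normr0.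
Qed.

Lemma pd_primitive i r f : rsmooth f -> line_supported i r f ->
  pd i (primitive i f) = f.
Proof.
move=> sf fr; rewrite (pd_int_line i _ sf fr)//.
by apply/funext => x; have [] := FTC_line x sf fr.
Qed.

(** To the left of the support the primitive is zero, to the right it is
    the total. *)
Lemma line_supported_primitive i r f : rsmooth f -> line_supported i r f ->
  line_total i f = (fun=> 0) -> line_supported i r (primitive i f).
Proof.
move=> sf fr I0 x; rewrite ltr_normr => /orP[rx|rx].
  have <- : line_total i f x = 0 by rewrite I0.
  rewrite /primitive /line_total /int_line Rintegral_mkcond; apply: eq_Rintegral => s _.
  rewrite patchE; case: ifPn => //; rewrite notin_setE /= in_itv /= => /negP.
  rewrite -ltNge => s0; rewrite fr// addZ_delta eqxx mulr1n.
  by rewrite (lt_le_trans _ (ler_norm _))//; lra.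
rewrite /primitive /int_line (@eq_Rintegral _ _ _ _ _ (fun=> 0)).
  by rewrite Rintegral_cst// mul0r.
move=> s; rewrite inE /= in_itv /= => s0; rewrite fr// addZ_delta eqxx mulr1n.
by rewrite -normrN (lt_le_trans _ (ler_norm _))//; lra.
Qed.

Lemma line_supported_int_line D i j r f : j != i -> line_supported j r f ->
  line_supported j r (int_line D i f).
Proof.
move=> ji fr x rx; rewrite /int_line (@eq_Rintegral _ _ _ _ _ (fun=> 0)).
  by rewrite /Rintegral integral0.
by move=> s _; rewrite fr// addZ_delta (negPf ji) mulr0n addr0.
Qed.

Lemma line_invariant_int_line D i j f : line_invariant j f ->
  line_invariant j (int_line D i f).
Proof.
move=> jf x t; apply: eq_Rintegral => s _.
by rewrite addrAC jf.
Qed.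

End line_operators.

(** * Functionals vanishing on derivatives *)

Section decomposition.
Variables (R : realType) (d : nat).
Local Notation E := 'rV[R]_d.
Local Notation ee i := (delta_mx ord0 i : E).
Implicit Types (f g u v w psi : E -> R) (x y : E) (i j : 'I_d) (r : R).

Lemma line_invariant_pd i j f : line_invariant i f -> line_invariant i (pd j f).
Proof.
move=> fi x t; have /(congr1 (fun g => g x)) := pds_shift [:: j] (t *: ee i) f.
by move=> /= <-; congr (pd j _ x); apply/funext => y; rewrite fi.
Qed.

Lemma line_invariant_iter_pd i j n f : line_invariant i f ->
  line_invariant i (iter n (pd j) f).
Proof. by move=> fi; elim: n => [//|n IH]; exact: line_invariant_pd. Qed.

Lemma line_supported_iter_pd i j n r f : line_supported i r f ->
  line_supported i r (iter n (pd j) f).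
Proof. by move=> fi; elim: n => [//|n IH]; exact: line_supported_pd. Qed.

Lemma iter_pdD n i f g : rsmooth f -> rsmooth g ->
  iter n (pd i) (fun x => f x + g x) = fun x => iter n (pd i) f x + iter n (pd i) g x.
Proof.
have e u : iter n (pd i) u = pds (nseq n i) u by elim: n => [//|n /= ->].
by rewrite !e; exact: pdsD.
Qed.

Lemma rsmooth_iter_pd j n f : rsmooth f -> rsmooth (iter n (pd j) f).
Proof. by move=> fi; elim: n => [//|n IH]; exact: rsmooth_pd. Qed.

Lemma line_invariant_cst f : (forall i, line_invariant i f) -> rsmooth f ->
  f = fun=> f 0.
Proof.
move=> fi sf; apply/funext => x; apply/eqP; rewrite -subr_eq0 -normr_le0.
have := @ball_lipschitz _ _ f 0 x 0 sf; rewrite mulr0 mul0r; apply => i z _.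
by rewrite (pd_line_invariant (fi i)) normr0.
Qed.

(** Operations in the direction [i] do not affect what concerns the other
    coordinates; this is the part of it needed to treat the coordinates in turn. *)
Definition inherits i f g := forall j, j != i ->
  (line_invariant j f -> line_invariant j g) /\
  (forall r, line_supported j r f -> line_supported j r g).

Variables (rho : 'I_d -> E -> R) (r0 : R).
Hypotheses (srho : forall i, rsmooth (rho i))
  (rho_supp : forall i, line_supported i r0 (rho i))
  (rho_inv : forall i j, j != i -> line_invariant j (rho i))
  (rho_total : forall i, line_total i (rho i) = fun=> 1).

(** Removing the right multiple of [rho i] makes the total zero, so that the
    primitive has bounded support again. *)
Definition balanced i f : E -> R := fun x => f x - line_total i f x * rho i x.

Section one_coordinate.
Variables (i : 'I_d) (r : R) (r0r : r0 <= r).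

Let supp_rho : line_supported i r (rho i) := line_supported_le r0r (@rho_supp i).

Lemma rsmooth_line_total f : rsmooth f -> line_supported i r f ->
  rsmooth (line_total i f).
Proof. exact: rsmooth_int_line measurableT. Qed.

Lemma rsmooth_balanced f : rsmooth f -> line_supported i r f -> rsmooth (balanced i f).
Proof.
move=> sf fr; rewrite (_ : balanced i f = fun x =>
  f x + (-1) * (line_total i f x * rho i x)).
  by apply: rsmoothD => //; apply/rsmoothZ/rsmoothM => //; exact: rsmooth_line_total.
by apply/funext => x; rewrite mulN1r.
Qed.

Lemma line_supported_balanced f : line_supported i r f ->
  line_supported i r (balanced i f).
Proof. by move=> fr x xr; rewrite /balanced fr// supp_rho// mulr0 subr0. Qed.

Lemma line_total_balanced f : rsmooth f -> line_supported i r f ->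
  line_total i (balanced i f) = fun=> 0.
Proof.
move=> sf fr; apply/funext => x; rewrite /line_total /int_line /balanced.
have Li := line_total_invariant sf fr.
have cf := rsmooth_continuous sf; have cr := rsmooth_continuous (srho i).
under eq_Rintegral do rewrite Li.
have ir := integrable_line x cr supp_rho measurableT.
rewrite RintegralB//; last 2 first.
- exact: integrable_line x cf fr measurableT.
- exact: (integrableZl measurableT _ ir).
rewrite RintegralZl//.
have := congr1 (fun g => g x) (rho_total i); rewrite /line_total /int_line => ->.
by rewrite mulr1 subrr.
Qed.

Lemma inherits_total f : inherits i f (line_total i f).
Proof.
move=> j ji; split=> [fj|r1 fj]; first exact: line_invariant_int_line.
exact: line_supported_int_line.
Qed.

Lemma line_total_decomposition f : rsmooth f -> line_supported i r f ->
  exists w, [/\ rsmooth w, line_supported i r w, inherits i f w &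
    f = fun x => line_total i f x * rho i x + pd i w x].
Proof.
move=> sf fr; exists (primitive i (balanced i f)).
have sb := rsmooth_balanced sf fr; have br := line_supported_balanced fr.
split.
- exact: rsmooth_int_line (measurable_itv _) sb br.
- exact: line_supported_primitive sb br (line_total_balanced sf fr).
- move=> j ji; have [Tinv Tsupp] := @inherits_total f j ji.
  split=> [fj|r1 fj].
    apply: line_invariant_int_line => x t.
    by rewrite /balanced fj (rho_inv ji) Tinv.
  apply: line_supported_int_line => // x xr.
  by rewrite /balanced fj// (Tsupp _ fj)// mul0r subr0.
- rewrite (pd_primitive sb br); apply/funext => x.
  by rewrite /balanced addrC subrK.
Qed.

Lemma inherits_trans f g h : inherits i f g -> inherits i g h -> inherits i f h.
Proof.
move=> fg gh j ji; have [fg1 fg2] := fg j ji; have [gh1 gh2] := gh j ji.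
by split=> [/fg1/gh1//|r1 /fg2/gh2].
Qed.

(** Each step applies [line_total_decomposition] to the remainder: its total
    contributes the next derivative of [rho i], with a coefficient that does not
    depend on the [i]-th coordinate, and the rest is once more a derivative. *)
Lemma iterated_decomposition n f : rsmooth f -> line_supported i r f ->
  exists (v : nat -> E -> R) w,
    [/\ forall k, [/\ rsmooth (v k), line_invariant i (v k) & inherits i f (v k)],
        [/\ rsmooth w, line_supported i r w & inherits i f w] &
        f = fun x => \sum_(k < n) v k x * iter k (pd i) (rho i) x
                     + iter n (pd i) w x].
Proof.
move=> sf fr; elim: n => [|n [v [w [vP [sw wr fw] fE]]]].
  exists (fun=> line_total i f), f; split => //; last first.
    by apply/funext => x; rewrite big_ord0 add0r.
  move=> _; split; [exact: rsmooth_line_total|exact: line_total_invariant fr|].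
  exact: inherits_total.
have [w' [sw' wr' ww' wE]] := line_total_decomposition sw wr.
have sI := rsmooth_line_total sw wr; have wI := line_total_invariant sw wr.
exists (fun k => if (k < n)%N then v k else line_total i w), w'; split.
- move=> k; case: ifP => _; first exact: vP.
  by split=> //; exact: inherits_trans fw (@inherits_total w).
- by split=> //; exact: inherits_trans fw ww'.
rewrite {1}fE; apply/funext => x; rewrite big_ord_recr /= ltnn -addrA; congr (_ + _).
  by apply: eq_bigr => k _; rewrite ltn_ord.
rewrite [in LHS]wE iter_pdD; [|exact: rsmoothM|exact: rsmooth_pd].
by rewrite (iter_pdM_line_invariant n sI (srho i) wI) -iterSr.
Qed.

End one_coordinate.

(** The real test functions.  That the support is bounded is said one
    coordinate at a time, the form in which it is preserved and used. *)
Definition rtest f := rsmooth f /\ exists r, forall i, line_supported i r f.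

Lemma rtestD f g : rtest f -> rtest g -> rtest (fun x => f x + g x).
Proof.
move=> [sf [r1 fr]] [sg [r2 gr]]; split; first exact: rsmoothD.
exists (Num.max r1 r2) => i x; rewrite gt_max => /andP[x1 x2].
by rewrite (fr i)// (gr i)// addr0.
Qed.

Lemma rtestMl u f : rsmooth u -> rtest f -> rtest (fun x => u x * f x).
Proof.
move=> su [sf [r fr]]; split; first exact: rsmoothM.
by exists r => i x xr; rewrite (fr i)// mulr0.
Qed.

Lemma rtestZ (c : R) f : rtest f -> rtest (fun x => c * f x).
Proof. by apply: rtestMl; exact: rsmooth_cst. Qed.

Lemma rtest0 : rtest (fun=> 0).
Proof. by split; [exact: rsmooth_cst|exists 0]. Qed.

Lemma rtest_sum n (F : 'I_n -> E -> R) : (forall k, rtest (F k)) ->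
  rtest (fun x => \sum_(k < n) F k x).
Proof.
elim: n F => [|n IH] F tF.
  by rewrite (_ : (fun _ => _) = fun=> 0); [exact: rtest0|apply/funext => x;
    rewrite big_ord0].
rewrite (_ : (fun _ => _) = fun x =>
  \sum_(k < n) F (widen_ord (leqnSn n) k) x + F ord_max x).
  by apply: rtestD => //; apply: IH.
by apply/funext => x; rewrite big_ord_recr.
Qed.

Lemma rtest_pd i f : rtest f -> rtest (pd i f).
Proof.
move=> [sf [r fr]]; split; first exact: rsmooth_pd.
by exists r => j; exact: line_supported_pd.
Qed.

Lemma rtest_iter_pd n i f : rtest f -> rtest (iter n (pd i) f).
Proof. by move=> tf; elim: n => [//|n IH]; exact: rtest_pd. Qed.

Variables (V : lmodType R) (M : nat) (S : (E -> R) -> V).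
Hypotheses (SD : forall f g, rtest f -> rtest g ->
    S (fun x => f x + g x) = S f + S g)
  (SZ : forall (c : R) f, rtest f -> S (fun x => c * f x) = c *: S f)
  (Sd : forall i f, rtest f -> S (iter M (pd i) f) = 0).

Let S_sum n (F : 'I_n -> E -> R) : (forall k, rtest (F k)) ->
  S (fun x => \sum_(k < n) F k x) = \sum_(k < n) S (F k).
Proof.
elim: n F => [|n IH] F tF.
  rewrite big_ord0 -[RHS](scale0r (S (fun=> 0))) -SZ; last exact: rtest0.
  by congr S; apply/funext => x; rewrite big_ord0 mul0r.
rewrite big_ord_recr /= -IH// -SD//; last exact: rtest_sum.
by congr S; apply/funext => x; rewrite big_ord_recr.
Qed.

Definition rho_prod k (alpha : 'I_d -> nat) : E -> R :=
  fun x => \prod_(i < d | (i < k)%N) iter (alpha i) (pd i) (rho i) x.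

Lemma rsmooth_rho_prod k alpha : rsmooth (rho_prod k alpha).
Proof. by apply: rsmooth_prod => i; exact: rsmooth_iter_pd. Qed.

Lemma rtest_rho_prod k alpha r u : rsmooth u ->
  (forall i : 'I_d, (k <= i)%N -> line_supported i r u) ->
  rtest (fun x => rho_prod k alpha x * u x).
Proof.
move=> su ur; split; first by apply: rsmoothM su; exact: rsmooth_rho_prod.
exists (Num.max r r0) => i x; rewrite gt_max => /andP[xr xr0].
have [ki|ik] := leqP k i; first by rewrite (ur i)// mulr0.
by rewrite /rho_prod (bigD1 i)//= (line_supported_iter_pd _ _ (@rho_supp i))// !mul0r.
Qed.

(** One coordinate after the other, [iterated_decomposition] replaces a test
    function, up to [M]-fold derivatives, by derivatives of the [rho i] times
    functions of the remaining coordinates; in the end only constants remain. *)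
Lemma functional_vanish :
  (forall alpha : {ffun 'I_d -> 'I_M}, S (rho_prod d (fun i => alpha i)) = 0) ->
  forall f, rtest f -> S f = 0.
Proof.
move=> Srho f [sf [r fr]].
suff H n k : (k + n = d)%N -> forall (alpha : 'I_d ->
  nat) r u, (forall i, (i < k)%N -> (alpha i < M)%N) ->
    rsmooth u -> (forall i : 'I_d, (i < k)%N -> line_invariant i u) ->
    (forall i : 'I_d, (k <= i)%N -> line_supported i r u) ->
    S (fun x => rho_prod k alpha x * u x) = 0.
  have := H d 0%N (add0n d) (fun=> 0%N) r f.
  rewrite (_ : (fun _ => _) = f); first by apply.
  by apply/funext => x; rewrite /rho_prod big_pred0 ?mul1r.
elim: n k => [|n IH] k kn alpha r1 u aM su ui us.
  have kd : k = d by rewrite -kn addn0.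
  rewrite kd in aM ui *.
  rewrite (line_invariant_cst (fun i => ui i (ltn_ord i)) su).
  rewrite (_ : (fun _ => _) = fun x => u 0 * rho_prod d alpha x); last first.
    by apply/funext => x; rewrite mulrC.
  rewrite SZ; last first.
    rewrite (_ : rho_prod d alpha = fun x => rho_prod d alpha x * 1).
      apply: (rtest_rho_prod _ (r := 0)); first exact: rsmooth_cst.
      by move=> i; rewrite leqNgt ltn_ord.
    by apply/funext => x; rewrite mulr1.
  pose beta : {ffun 'I_d -> 'I_M} := [ffun i => Ordinal (aM i (ltn_ord i))].
  have := Srho beta; rewrite (_ : rho_prod d (fun i => beta i) = rho_prod d alpha).
    by move=> ->; rewrite scaler0.
  by apply/funext => x; apply: eq_bigr => i _; rewrite ffunE.
have kd : (k < d)%N by rewrite -kn -addSnnS leq_addr.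
pose i0 := Ordinal kd; pose r2 := Num.max r1 r0.
have r02 : r0 <= r2 by rewrite le_max lexx orbT.
have us2 i : (k <= i)%N -> line_supported i r2 u.
  by move=> ki; apply: line_supported_le (us i ki); rewrite le_max lexx.
have [v [w [vP [sw wr uw] uE]]] := iterated_decomposition r02 M su (us2 i0 (leqnn k)).
have Pinv al : line_invariant i0 (rho_prod k al).
  move=> x t; apply: eq_bigr => i ik.
  by rewrite (line_invariant_iter_pd _ _ (rho_inv _))// -(inj_eq val_inj) /= gtn_eqF.
have Pstep (b : nat) x : rho_prod k alpha x * iter b (pd i0) (rho i0) x =
    rho_prod k.+1 (fun i => if i == i0 then b else alpha i) x.
  rewrite /rho_prod [RHS](bigD1 i0)/= ?ltnSn// eqxx mulrC; congr (_ * _).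
  apply: eq_big => [i|i ik].
    by rewrite ltnS [RHS]andbC -(inj_eq val_inj) /= -ltn_neqAle.
  by rewrite -(inj_eq val_inj) /= ltn_eqF.
have tv (j : 'I_M) : rtest (fun x => rho_prod k.+1
    (fun i => if i == i0 then j : nat else alpha i) x * v j x).
  have [sv vi uv] := vP j; apply: (rtest_rho_prod _ (r := r2)) => // i ki.
  have i0i : i != i0 by rewrite -(inj_eq val_inj) /= gtn_eqF.
  by have [_] := uv i i0i; apply; apply: us2; exact: ltnW.
have tw : rtest (fun x => rho_prod k alpha x * w x).
  apply: (rtest_rho_prod _ (r := r2)) => // i ki.
  have [->|i0i] := eqVneq i i0; first exact: wr.
  by have [_] := uw i i0i; apply; exact: us2.
rewrite (_ : (fun _ => _) = fun x => \sum_(j < M) (rho_prod k.+1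
    (fun i => if i == i0 then j : nat else alpha i) x * v j x) +
    iter M (pd i0) (fun x => rho_prod k alpha x * w x) x); last first.
  rewrite (iter_pdM_line_invariant M (rsmooth_rho_prod k alpha) sw (Pinv alpha)).
  rewrite {1}uE; apply/funext => x; rewrite mulrDr mulr_sumr; congr (_ + _).
  by apply: eq_bigr => j _; rewrite mulrCA mulrC -Pstep mulrC.
rewrite SD; [|exact: rtest_sum|exact: rtest_iter_pd].
rewrite Sd// addr0 S_sum// big1// => j _.
have [sv vi uv] := vP j; apply: (IH k.+1 _ _ r2) => //.
- by rewrite addSnnS.
- move=> i; rewrite ltnS leq_eqVlt -(inj_eq val_inj) /=.
  by case: eqP => //= _; exact: aM.
- move=> i; rewrite ltnS leq_eqVlt => /orP[/eqP ik|ik].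
    by have -> : i = i0 by exact: val_inj.
  have i0i : i != i0 by rewrite -(inj_eq val_inj) /= ltn_eqF.
  by have [+ _] := uv i i0i; apply; exact: ui.
- move=> i ki; have i0i : i != i0 by rewrite -(inj_eq val_inj) /= gtn_eqF.
  by have [_] := uv i i0i; apply; apply: us2; exact: ltnW.
Qed.

End decomposition.

(** * Distributions as functionals on real test functions *)

Section complex_bridge.
Variables (R : realType) (d : nat).
Local Notation C := (Rcomplex R).
Local Notation E := 'rV[R]_d.
Local Notation ee i := (delta_mx ord0 i : E).
Local Notation Re := (@complex.Re R).
Local Notation Im := (@complex.Im R).
Implicit Types (f g : E -> R) (F : E -> C) (x y : E) (i j : 'I_d).

Definition cplx f : E -> C := fun x => (f x)%:A.

Lemma norm_Re_le (z : C) : `|Re z : R| <= `|z|.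
Proof.
case: z => a b; rewrite [leRHS]/Num.norm /= -sqrtr_sqr ler_wsqrtr// lerDl.
exact: sqr_ge0.
Qed.

Lemma norm_Im_le (z : C) : `|Im z : R| <= `|z|.
Proof.
case: z => a b; rewrite [leRHS]/Num.norm /= -sqrtr_sqr ler_wsqrtr// lerDr.
exact: sqr_ge0.
Qed.

Lemma norm_realA (r : R) : `|r%:A : C| = `|r|.
Proof. by rewrite normrZ [X in _ * X]Normc.normc1 mulr1. Qed.

Lemma continuous_bounded_linear (V W : normedModType R) (L : V -> W) :
  linear L -> (forall v, `|L v| <= `|v|) -> continuous L.
Proof.
move=> linL Lle x.
pose L' : {linear V -> W} := HB.pack L (GRing.isLinear.Build _ _ _ _ L linL).
apply: (continuous_lipschitz (C := 1)) => y _; rewrite mul1r.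
by rewrite -[L]/(L' : V -> W) -raddfB; exact: Lle.
Qed.

Lemma linear_Re : linear (Re : C -> R). Proof. by move=> a [x1 y1] [x2 y2]. Qed.
Lemma linear_Im : linear (Im : C -> R). Proof. by move=> a [x1 y1] [x2 y2]. Qed.
Lemma linear_realA : linear (fun r : R => r%:A : C).
Proof. by move=> a x y; rewrite scalerDl scalerA. Qed.

Lemma continuous_Re : continuous (Re : C -> R).
Proof. exact: (continuous_bounded_linear linear_Re norm_Re_le). Qed.
Lemma continuous_Im : continuous (Im : C -> R).
Proof. exact: (continuous_bounded_linear linear_Im norm_Im_le). Qed.
Lemma continuous_realA : continuous (fun r : R => r%:A : C).
Proof.
by apply: (continuous_bounded_linear linear_realA) => r; rewrite norm_realA.
Qed.

Lemma rsmooth_part (L : C -> R) F : linear L -> continuous L -> smooth F ->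
  rsmooth (L \o F) /\ forall s, pds s (L \o F) = L \o partials s F.
Proof.
move=> linL cL sF.
have e s : pds s (L \o F) = L \o partials s F.
  elim: s => [//|i s IH]; rewrite [LHS]/= IH; apply/funext => x.
  have [_ dF] := sF s.
  by have [_] := is_derive_linear linL cL (dF i x).
split=> // s; rewrite e; have [cF dF] := sF s; split=> [x|i x].
  exact: (continuous_comp (cF x) (cL _)).
by have [] := is_derive_linear linL cL (dF i x).
Qed.

Lemma partials_cplx f s : rsmooth f -> partials s (cplx f) = cplx (pds s f).
Proof.
move=> sf; elim: s => [//|i s IH]; rewrite [LHS]/= IH; apply/funext => x.
have [_ df] := sf s.
by have [_] := is_derive_linear linear_realA continuous_realA (df i x).
Qed.

Lemma smooth_cplx f : rsmooth f -> smooth (cplx f).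
Proof.
move=> sf s; rewrite partials_cplx//; have [cf df] := sf s; split=> [x|i x].
  apply: (@continuous_comp _ _ _ (pds s f) (fun r : R => r%:A : C)); first exact: cf.
  exact: continuous_realA.
by have [] := is_derive_linear linear_realA continuous_realA (df i x).
Qed.

Lemma rtest_norm f : rtest f -> exists r, forall x, r < `|x| -> f x = 0.
Proof.
move=> [_ [r fr]]; exists `|r| => x;
  rewrite ltNge rV_norm_le// negb_forall => /existsP[k].
by rewrite -ltNge => rx; rewrite (fr k)//; exact: le_lt_trans (ler_norm r) rx.
Qed.

Lemma closed_support_subset F r : (forall x, r < `|x| -> F x = 0) ->
  closed_support F `<=` closed_ball_ (fun z : E => `|z|) 0 r.
Proof.
move=> Fr; rewrite /closed_support.
have /closure_id cl := @closed_closed_ball_ R E 0 r.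
rewrite [X in _ `<=` X]cl; apply: closureS => x /= Fx.
rewrite /closed_ball_ /= sub0r normrN leNgt; apply/negP => /Fr F0.
by rewrite F0 eqxx in Fx.
Qed.

Lemma compact_closed_ball r : compact (closed_ball_ (fun z : E => `|z|) 0 r).
Proof.
apply: bounded_closed_compact; last exact: closed_closed_ball_.
exists r; split; first exact: num_real.
by move=> M rM y; rewrite /closed_ball_ /= sub0r normrN => /le_trans; apply; exact: ltW.
Qed.

Lemma compact_support_cplx f : rtest f -> compact (closed_support (cplx f)).
Proof.
move=> /rtest_norm[r fr]; apply: (subclosed_compact _ (@compact_closed_ball r)).
  exact: closed_closure.
by apply: closed_support_subset => x /fr; rewrite /cplx => ->; rewrite scale0r.
Qed.

Definition test_of f (tf : rtest f) : test_function R d :=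
  TestFunction (smooth_cplx tf.1) (compact_support_cplx tf).

Lemma test_function_ext (phi psi : test_function R d) :
  test_fun phi = test_fun psi -> phi = psi.
Proof.
case: phi psi => f sf cf [g sg cg] /= fg; move: sf cf sg cg; rewrite fg => *.
by congr TestFunction; exact: Prop_irrelevance.
Qed.

Lemma rtest_part (L : C -> R) (phi : test_function R d) :
  linear L -> continuous L -> rtest (L \o phi).
Proof.
move=> linL cL; have [sL _] := rsmooth_part linL cL (test_smooth phi).
split=> //; have /compact_bounded[M [_ HM]] := @test_compact _ _ phi.
exists (`|M| + 1) => i x xM.
have [phi0|phix] := eqVneq (phi x) 0.
  by have := linL (-1) 0 0; rewrite /= phi0 scaler0 addr0 scaleN1r addNr.
have : `|x| <= `|M| + 1.
  apply: HM; first by rewrite (le_lt_trans (ler_norm M))// ltrDl.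
  exact: subset_closure.
by move/(le_trans (rV_coord_le x i)); rewrite leNgt xM.
Qed.

Section real_functional.
Variable T : schwartz_distribution R d.

(** [T] on real test functions, extended by the junk value [0] so that its
    argument is a bare function. *)
Definition rfun f : C :=
  match pselect (rtest f) with left tf => T (test_of tf) | right _ => 0 end.

Lemma rfunE f (tf : rtest f) : rfun f = T (test_of tf).
Proof.
by rewrite /rfun; case: pselect => // tf'; congr (distr_fun T _);
  exact: test_function_ext.
Qed.

Lemma rfunD f g : rtest f -> rtest g -> rfun (fun x => f x + g x) = rfun f + rfun g.
Proof.
move=> tf tg; rewrite (rfunE tf) (rfunE tg) (rfunE (rtestD tf tg)).
rewrite -[X in X + _]mul1r -distr_linear; congr (distr_fun T _).
by apply: test_function_ext; apply/funext => x /=; rewrite mul1r /cplx scalerDl.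
Qed.

Lemma rfunZ (c : R) f : rtest f -> rfun (fun x => c * f x) = c *: rfun f.
Proof.
move=> tf; rewrite (rfunE tf) (rfunE (rtestZ c tf)).
have := distr_linear T (c%:A - 1) (test_of tf) (test_of tf).
rewrite mulrBl mul1r subrK mulr_algl => <-; congr (distr_fun T _).
apply: test_function_ext; apply/funext => x /=; rewrite mulrBl mul1r subrK mulr_algl.
by rewrite /cplx scalerA.
Qed.

Lemma rfunB f g : rtest f -> rtest g -> rfun (fun x => f x - g x) = rfun f - rfun g.
Proof.
move=> tf tg; rewrite -scaleN1r -rfunZ// -rfunD//; last exact: rtestZ.
by congr rfun; apply/funext => x; rewrite mulN1r.
Qed.

Lemma distr_parts (phi : test_function R d) :
  T phi = rfun (Re \o phi) + 'i%C * rfun (Im \o phi).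
Proof.
have tR := rtest_part phi linear_Re continuous_Re.
have tI := rtest_part phi linear_Im continuous_Im.
rewrite (rfunE tR) (rfunE tI) addrC -distr_linear; congr (distr_fun T _).
apply: test_function_ext; apply/funext => x /=; rewrite /cplx /=.
by case: (phi x) => a b; apply/eqP; rewrite eq_complex /=; apply/andP; split;
  apply/eqP; ring.
Qed.

Lemma mpartial_partials (alpha : 'I_d -> nat) F :
  mpartial alpha F = partials (flatten [seq nseq (alpha i) i | i <- enum 'I_d]) F.
Proof.
rewrite /mpartial; elim: (enum 'I_d) => [//|i s IH].
rewrite /= /partials foldr_cat; move: IH; rewrite /partials => <-.
by elim: (alpha i) => [//|n IHn]; rewrite iterS IHn.
Qed.

(** The continuity of [T] on the functions supported in a fixed ball, in the
    form in which all derivatives up to the order [N] have one common bound. *)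
Lemma rfun_estimate r : exists (c : R) (N : nat), 0 <= c /\
  forall f e, rtest f -> (forall x, r < `|x| -> f x = 0) -> 0 <= e ->
    (forall s x, (size s <= N)%N -> `|pds s f x| <= e) -> `|rfun f| <= c * e.
Proof.
have [c [N TN]] := distr_continuous T (@compact_closed_ball r).
pose n := #|[pred alpha : {ffun 'I_d -> 'I_N.+1} | (\sum_i alpha i <= N)%N]|.
exists (`|c| * n%:R), N; split; first by rewrite mulr_ge0.
move=> f e tf fr e0 H; rewrite (rfunE tf).
apply: le_trans (TN (test_of tf) _) _.
  by apply: closed_support_subset => x /fr; rewrite /= /cplx => ->; rewrite scale0r.
rewrite -mulrA; set A := \sum_(alpha | _) _.
have A0 : 0 <= A <= n%:R * e.
  have supP (alpha : {ffun 'I_d -> 'I_N.+1}) : (\sum_i alpha i <= N)%N ->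
      0 <= sup [set `|mpartial (fun i => alpha i) (test_of tf) x| |
        x in [set: E]] <= e.
    move=> aN; set Z := [set _ | _ in _].
    have Ze : ubound Z e.
      move=> _ [x _ <-]; rewrite mpartial_partials /= partials_cplx; last exact: tf.1.
      rewrite norm_realA; apply: H; apply: leq_trans aN.
      rewrite size_flatten /shape -map_comp sumnE big_map big_enum /=.
      by under eq_bigr do rewrite size_nseq.
    have Z0 : Z `|mpartial (fun i => alpha i) (test_of tf) 0| by exists 0.
    apply/andP; split; last by apply: ge_sup Ze; eexists; exact: Z0.
    apply: (le_trans (normr_ge0 (mpartial (fun i => alpha i) (test_of tf) 0))).
    by apply: ub_le_sup Z0; exists e.
  apply/andP; split; first by apply: sumr_ge0 => alpha /supP/andP[].
  rewrite mulr_natl -sumr_const; apply: ler_sum => alpha aN.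
  by have /andP[] := supP alpha aN.
case/andP: A0 => A0 Ae; apply: (@le_trans _ _ (`|c| * A)).
  by rewrite ler_wpM2r// ler_norm.
exact: ler_wpM2l.
Qed.

Lemma pds_bounded f N : rtest f ->
  exists2 B, 0 <= B & forall s x, (size s <= N)%N -> `|pds s f x| <= B.
Proof.
elim: N f => [|N IH] f tf; have [r fr] := rtest_norm tf;
  have [B0 B00 HB0] := continuous_bounded_ball 0 r (rsmooth_continuous tf.1).
  exists B0 => // s x; rewrite leqn0 => /nilP-> /=.
  have [xr|rx] := leP `|x| r; first by apply: HB0; rewrite subr0.
  by rewrite fr// normr0.
have fB0 x : `|f x| <= B0.
  have [xr|rx] := leP `|x| r; first by apply: HB0; rewrite subr0.
  by rewrite fr// normr0.
have /choice[B BP] : forall i, exists B, 0 <= B /\ forall s x, (size s <= N)%N ->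
    `|pds s (pd i f) x| <= B.
  by move=> i; have [B B0' HB] := IH _ (rtest_pd i tf); exists B.
have sB0 : 0 <= \sum_i B i by apply: sumr_ge0 => i _; case: (BP i).
exists (B0 + \sum_i B i); first exact: addr_ge0.
move=> s x; case/lastP: s => [_|s i]; first by apply: le_trans (fB0 x) _; rewrite lerDl.
rewrite size_rcons ltnS => sN; rewrite -cats1 pds_cat.
apply: le_trans (proj2 (BP i) s x sN) _; apply: ler_wpDl => //.
by rewrite (bigD1 i)//= lerDl sumr_ge0// => j _; case: (BP j).
Qed.

Definition orbit_fun f x : C := rfun (fun y => f (y + x)).

Lemma rtest_shift x f : rtest f -> rtest (fun y => f (y + x)).
Proof.
move=> [sf [r fr]]; split; first exact: rsmooth_shift.
exists (r + `|x|) => i y ry; apply: (fr i); rewrite mxE.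
have := lerB_dist (y ord0 i) (- x ord0 i); rewrite opprK normrN.
by have := rV_coord_le x i; lra.
Qed.

(** Every derivative of a test function is Lipschitz, so translating it by a
    small vector changes all seminorms by little. *)
Lemma continuous_orbit f : rtest f -> continuous (orbit_fun f).
Proof.
move=> tf x; have [r fr] := rtest_norm tf.
have [c [N [c0 HN]]] := rfun_estimate (r + `|x| + 1).
have [B B0 HB] := pds_bounded N.+1 tf.
apply: (continuous_lipschitz (C := c * (d%:R * B))) => y yx.
have ty := rtest_shift y tf; have tx := rtest_shift x tf.
rewrite /orbit_fun -rfunB// -!mulrA; apply: HN.
- rewrite (_ : (fun _ => _) = fun z => f (z + y) + (-1) * f (z + x)).
    by apply: rtestD => //; exact: rtestZ.
  by apply/funext => z; rewrite mulN1r.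
- move=> z rz; rewrite !fr ?subrr//.
    by have := ler_normB (z + x) x; rewrite addrK; lra.
  have := ler_normB (z + y) y; rewrite addrK.
  have := ler_normD (y - x) x; rewrite subrK; lra.
- by rewrite !mulr_ge0.
move=> s z sN.
have -> : pds s (fun u => f (u + y) - f (u + x)) z = pds s f (z + y) - pds s f (z + x).
  rewrite (_ : (fun u => _) = fun u => f (u + y) + (-1) * f (u + x)); last first.
    by apply/funext => u; rewrite mulN1r.
  rewrite pdsD; [|exact: ty.1|exact: (rtestZ _ tx).1].
  by rewrite pdsZ ?mulN1r ?pds_shift//; exact: tx.1.
rewrite (_ : y - x = (z + y) - (z + x)); last by rewrite opprD addrACA subrr add0r.
rewrite mulrA; apply: ball_lipschitz; first exact/rsmooth_pds/tf.1.
by move=> i u _; apply: (HB (i :: s)).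
Qed.

Lemma pds_pd_comm f s i : rsmooth f -> pds s (pd i f) = pd i (pds s f).
Proof.
move=> sf; elim: s => [//|j s IH]; rewrite [LHS]/= IH.
by apply: pd_comm; exact: rsmooth_pds.
Qed.

Lemma pdsB s f g : rsmooth f -> rsmooth g ->
  pds s (fun x => f x - g x) = fun x => pds s f x - pds s g x.
Proof.
move=> sf sg; rewrite (_ : (fun x => _) = fun x => f x + (-1) * g x); last first.
  by apply/funext => u; rewrite mulN1r.
rewrite (pdsD _ sf (rsmoothZ _ sg)) (pdsZ _ _ sg).
by apply/funext => u; rewrite mulN1r.
Qed.

Lemma rtestB f g : rtest f -> rtest g -> rtest (fun x => f x - g x).
Proof.
move=> tf tg; rewrite (_ : (fun x => _) = fun x => f x + (-1) * g x).
  by apply: rtestD => //; exact: rtestZ.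
by apply/funext => u; rewrite mulN1r.
Qed.

(** Since partial derivatives commute, a derivative of the Taylor remainder of
    [f] is the Taylor remainder of a derivative of [f], which is quadratic. *)
Lemma orbit_taylor f x i : rtest f -> exists B : R, forall t : R, `|t| <= 1 ->
  `|orbit_fun f (x + t *: ee i) - orbit_fun f x - t *: orbit_fun (pd i f) x|
     <= B * `|t| ^+ 2.
Proof.
move=> tf; have [r fr] := rtest_norm tf.
have tdf := rtest_pd i tf; have [r' dfr] := rtest_norm tdf.
pose q := Num.max r r'.
have [c [N [c0 HN]]] := rfun_estimate (q + `|x| + 1).
have [B B0 HB] := pds_bounded N.+2 tf.
exists (c * B) => t t1.
have te : `|t *: ee i| <= 1 by exact: le_trans (norm_scale_delta i t) t1.
have ty := rtest_shift (x + t *: ee i) tf; have tx := rtest_shift x tf.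
have tdx := rtest_shift x tdf.
rewrite /orbit_fun -rfunZ// -rfunB// -rfunB//; [|exact: rtestB|exact: rtestZ].
rewrite -mulrA; apply: HN.
- by apply: rtestB; [exact: rtestB|exact: rtestZ].
- move=> z rz; have qr : r <= q by rewrite le_max lexx.
  have qr' : r' <= q by rewrite le_max lexx orbT.
  have zx := ler_normB (z + x) x; rewrite addrK in zx.
  have zy := ler_normB (z + (x + t *: ee i)) (x + t *: ee i); rewrite addrK in zy.
  have xe := ler_normD x (t *: ee i).
  rewrite (fr (z + x)); last lra.
  rewrite (fr (z + (x + _))); last lra.
  by rewrite (dfr (z + x)) ?mulr0 ?subrr//; lra.
- by rewrite mulr_ge0// exprn_ge0.
move=> s z sN.
rewrite (pdsB _ (rtestB ty tx).1 (rtestZ _ tdx).1) (pdsB _ ty.1 tx.1) (pdsZ _ _ tdx.1).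
rewrite !pds_shift (pds_pd_comm _ _ tf.1) addrA.
apply: line_taylor; first exact/rsmooth_pds/tf.1.
by move=> u _; apply: (HB (i :: i :: s)).
Qed.

Lemma is_derive_orbit f i (s : R) : rtest f ->
  is_derive s 1 (fun t : R => orbit_fun f (t *: ee i)) (orbit_fun (pd i f) (s *: ee i)).
Proof.
move=> tf; have [B HB] := orbit_taylor (s *: ee i) i tf.
apply: (is_derive_quadratic (C := B)) => t t1.
by rewrite -[t *: 1]/(t * 1) mulr1 scalerDl; exact: HB.
Qed.

(** Differentiating in [t] lowers the degree of the polynomial
    [t |-> T (f (. + t e_i))] and differentiates the test function. *)
Lemma rfun_iter_pd n f i (a : nat -> C) : rtest f ->
  (forall t : R, orbit_fun f (t *: ee i) = \sum_(k < n) t ^+ k *: a k) ->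
  rfun (iter n (pd i) f) = 0.
Proof.
elim: n f a => [|n IH] f a tf H.
  have := H 0; rewrite big_ord0 scale0r /orbit_fun => <-.
  by congr rfun; apply/funext => y; rewrite addr0.
rewrite iterSr; apply: (IH _ (fun k => k.+1%:R *: a k.+1)); first exact: rtest_pd.
move=> t; have [_ <-] := is_derive_orbit i t tf.
under eq_fun do rewrite H.
have D (k : 'I_n.+1) : is_derive t 1 (fun t : R =>
  t ^+ k *: a k) ((k%:R * t ^+ k.-1) *: a k).
  have linS : linear (fun r : R => r *: a k) by move=> b x y; rewrite scalerDl scalerA.
  have cS : continuous (fun r : R => r *: a k).
    by move=> u; apply: (cvgZ (F := nbhs u)); [exact: cvg_id|exact: cvg_cst].
  have := is_derive_linear linS cS (@exprn_derivable _ k t 1).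
  by rewrite exp_derive [_ *: 1]mulr1.
rewrite (_ : (fun t => _) = \sum_(k < n.+1) (fun t : R => t ^+ k *: a k)); last first.
  by apply/funext => u; rewrite fct_sumE.
have [_ ->] := is_derive_sum D.
rewrite big_ord_recl mul0r scale0r add0r; apply: eq_bigr => k _.
by rewrite scalerA mulrC.
Qed.

End real_functional.
End complex_bridge.

(** * Integration over tuples *)

Section tuple_measurability.
Variables (R : realType) (n : nat).
Local Notation tR := (n.-tuple (measurableTypeR R)).
Local Notation E := 'rV[R]_n.

Definition row_of_tuple (t : tR) : E := \row_i tnth t i.

Let index (k : nat) (t : tR) : {ffun 'I_n -> int} :=
  [ffun i => Num.floor (k.+1%:R * (tnth t i : R))].

Let grid (k : nat) (c : {ffun 'I_n -> int}) : E := \row_i ((c i)%:~R / k.+1%:R).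

Let measurable_index k c : measurable (index k @^-1` [set c]).
Proof.
rewrite (_ : _ @^-1` _ = \bigcap_(i in [set: 'I_n]) ((fun t : tR => tnth t i) @^-1`
    `[(c i)%:~R / k.+1%:R, ((c i + 1)%:~R / k.+1%:R : R)[%classic)).
  apply: fin_bigcap_measurable => [|i _]; first exact: finite_finset.
  by rewrite -[X in measurable X]setTI; apply: measurable_tnth => //;
    exact: measurable_itv.
have k0 : 0 < k.+1%:R :> R by [].
apply/seteqP; split=> t /= H.
  move=> i _ /=; rewrite in_itv /= ler_pdivrMr// ltr_pdivlMr//.
  have -> : c i = Num.floor (k.+1%:R * (tnth t i : R)) by rewrite -H ffunE.
  by rewrite [tnth t i * _]mulrC; exact: floor_itv.
apply/ffunP => i; rewrite ffunE; apply: floor_def.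
have := H i Logic.I; rewrite /= in_itv /= ler_pdivrMr// ltr_pdivlMr//.
by rewrite [tnth t i * _]mulrC.
Qed.

Let grid_index k t : `|grid k (index k t) - row_of_tuple t| <= k.+1%:R^-1.
Proof.
have k0 : 0 < k.+1%:R :> R by [].
rewrite rV_norm_le ?invr_ge0//; apply/forallP => i; rewrite !mxE ffunE.
set x : R := tnth t i; set z := Num.floor _.
have -> : z%:~R / k.+1%:R - x = (z%:~R - k.+1%:R * x) / k.+1%:R.
  by rewrite mulrBl [k.+1%:R * x]mulrC mulfK// gt_eqF.
rewrite normrM normfV [X in _ / X]ger0_norm// ler_pdivrMr// mulVf ?gt_eqF//.
have /andP[h1 h2] : z%:~R <= k.+1%:R * x < (z + 1)%:~R by exact: floor_itv.
by rewrite intrD in h2; rewrite ler_norml; apply/andP; split; lra.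
Qed.

(** The sigma-algebra generated by the coordinates contains the open sets: a
    continuous function is the limit of its values at the nearest points of the
    countable grids (Z/(k+1))^n. *)
Lemma measurable_row_of_tuple (g : E -> R) : continuous g ->
  measurable_fun setT (g \o row_of_tuple).
Proof.
move=> cg; apply: (@measurable_fun_cvg _ _ _ setT (fun k t => g (grid k (index k t)))).
  move=> k _ B mB; rewrite setTI.
  pose F m := if unpickle m is Some c then
    (if g (grid k c) \in B then index k @^-1` [set c] else set0) else set0.
  rewrite (_ : _ @^-1` _ = \bigcup_m F m).
    apply: bigcupT_measurable => m; rewrite /F.
    by case: unpickle => // c; case: ifP => // _; exact: measurable_index.
  apply/seteqP; split=> t /=.
    by move=> Bt; exists (pickle (index k t)) => //; rewrite /F pickleK mem_set.
  by move=> [m _]; rewrite /F; case: unpickle => // c; case: ifPn => // /set_mem Bc ->.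
move=> t _; apply: (continuous_cvg _ (cg (row_of_tuple t))).
apply/cvgrPdist_le => e e0; near=> k.
rewrite distrC; apply: le_trans (grid_index k t) _.
by near: k; apply: filterS (near_infty_natSinv_lt (PosNum e0)) => k; exact: ltW.
Unshelve. all: by end_near. Qed.

End tuple_measurability.

Section bounded_integrable.
Context {disp : measure_display} {X : measurableType disp} {R : realType}.
Variable m : {measure set X -> \bar R}.

Lemma integrable_bounded_off (A : set X) (g : X -> R) (C : R) : measurable A ->
  (m A < +oo)%E -> measurable_fun setT g -> (forall x, `|g x| <= C) ->
  (forall x, ~ A x -> g x = 0) -> m.-integrable setT (EFin \o g).
Proof.
move=> mA Afin mg gC gA.
have -> : EFin \o g = (EFin \o g) \_ A.
  apply/funext => x; rewrite patchE; case: ifPn => //.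
  by rewrite notin_setE => /gA /= ->.
apply: (integrable_mkcond _ mA).1; apply: measurable_bounded_integrable => //.
  exact: measurable_funTS.
exists C; split; first exact: num_real.
by move=> M CM x _; exact: le_trans (gC x) (ltW CM).
Qed.

End bounded_integrable.

Section tuple_integral.
Variable R : realType.
Local Notation tR n := (n.-tuple (measurableTypeR R)).
Local Notation lam := (@lebesgue_measure R).
Local Notation mu n := (lebesgue_tuple R n).

Definition cube n (K : R) : set (tR n) := [set t | forall i, `|(tnth t i : R)| <= K].

Arguments cube : clear implicits.

Lemma measurable_cube n K : measurable (cube n K).
Proof.
rewrite (_ : cube n K = \bigcap_(i in [set: 'I_n]) ((fun t : tR n => tnth t i) @^-1`
    `[- K, K]%classic)).
  apply: fin_bigcap_measurable => [|i _]; first exact: finite_finset.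
  by rewrite -[X in measurable X]setTI; apply: measurable_tnth => //;
    exact: measurable_itv.
apply/seteqP; split=> t H i => [_|]; first by rewrite /= in_itv /= -ler_norml; exact: H.
by have := H i Logic.I; rewrite /= in_itv /= -ler_norml.
Qed.

Lemma tnth_cons0 n (x : R) (t : tR n) : tnth (cons_pair (x, t)) ord0 = x.
Proof. by []. Qed.

Lemma tnth_consS n (x : R) (t : tR n) i : tnth (cons_pair (x, t)) (lift ord0 i) =
  tnth t i.
Proof. by rewrite !(tnth_nth x). Qed.

Lemma preimage_cube n K : @cons_pair R n @^-1` cube n.+1 K =
  `[- K, K]%classic `*` cube n K.
Proof.
apply/seteqP; split=> -[x t] /= H.
  split=> [|i]; first by have := H ord0; rewrite tnth_cons0 /= in_itv /= -ler_norml.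
  by have := H (lift ord0 i); rewrite tnth_consS.
case: H => /=; rewrite in_itv /= -ler_norml => Hx Ht i.
by case: (unliftP ord0 i) => [j|] ->; rewrite ?tnth_consS// tnth_cons0.
Qed.

Lemma cube_fin n K : (mu n (cube n K) < +oo)%E.
Proof.
elim: n => [|n IH] /=; first by rewrite diracE ltry.
rewrite /lebesgue_cons /pushforward preimage_cube.
have mI : measurable (`[- K, K]%classic : set (measurableTypeR R)) by exact:
  measurable_itv.
have lI : lam `[(- K)%R, K]%classic \is a fin_num.
  by rewrite lebesgue_measure_itv /=; case: ifP.
by rewrite (product_measure1E _ _ mI (@measurable_cube n K)) lte_mul_pinfty.
Qed.

Lemma cube_pair_fin n K : ((lam \x mu n) (@cons_pair R n @^-1` cube n.+1 K) < +oo)%E.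
Proof. exact: (@cube_fin n.+1 K). Qed.

Definition cube_function n (g : tR n -> R) := measurable_fun setT g /\
  exists K C : R, (forall t, `|g t| <= C) /\ forall t i, K < `|(tnth t i : R)| ->
    g t = 0.

Lemma cube_function_off n (g : tR n -> R) K :
  (forall t i, K < `|(tnth t i : R)| -> g t = 0) -> forall t, ~ cube n K t -> g t = 0.
Proof.
move=> gK t /existsNP[k] /negP; rewrite -ltNge; exact: gK.
Qed.

Lemma cube_function_integrable n g : @cube_function n g ->
  (mu n).-integrable setT (EFin \o g).
Proof.
move=> [mg [K [C [gC gK]]]].
exact: (integrable_bounded_off (@measurable_cube n K) (@cube_fin n K) mg gC
  (cube_function_off gK)).
Qed.

Lemma cube_function_pair n g : @cube_function n.+1 g ->
  (lam \x mu n)%E.-integrable setT (EFin \o (g \o @cons_pair R n)).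
Proof.
move=> [mg [K [C [gC gK]]]].
apply: (integrable_bounded_off (A := @cons_pair R n @^-1` cube n.+1 K) (C := C)).
- rewrite -[X in measurable X]setTI; apply: measurable_cons_pair => //.
  exact: measurable_cube.
- exact: cube_pair_fin.
- apply: measurableT_comp => //; exact: measurable_cons_pair.
- by move=> p /=.
- by move=> p /= /(cube_function_off gK).
Qed.

Lemma cube_function_section n g x : @cube_function n.+1 g ->
  cube_function (fun t : tR n => g (cons_pair (x, t))).
Proof.
move=> [mg [K [C [gC gK]]]]; split.
  apply: (measurableT_comp mg); apply: (measurableT_comp (@measurable_cons_pair R n)).
  exact: pair1_measurable.
exists K, C; split=> // t i; rewrite -(tnth_consS x); exact: gK.
Qed.

Lemma lebesgue_tupleS n g : @cube_function n.+1 g ->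
  (\int[mu n.+1]_t (g t)%:E = \int[lam \x mu n]_p (g (cons_pair p))%:E)%E.
Proof.
move=> ng; rewrite /= /lebesgue_cons.
have [mg _] := ng.
rewrite (integral_pushforward (@measurable_cons_pair R n) (f := EFin \o g))//.
- exact/measurable_EFinP.
- exact: cube_function_pair.
Qed.

Lemma cube_function_line n g t : @cube_function n.+1 g ->
  lam.-integrable setT (EFin \o (fun x : measurableTypeR R => g (cons_pair (x, t)))).
Proof.
move=> [mg [K [C [gC gK]]]].
have mI : measurable (`[- K, K]%classic : set (measurableTypeR R)) by exact:
  measurable_itv.
have lI : (lam `[(- K)%R, K]%classic < +oo)%E.
  by rewrite lebesgue_measure_itv /=; case: ifP => _; rewrite ?ltry// -EFinB ltry.
apply: (integrable_bounded_off (C := C) mI lI).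
- apply: (measurableT_comp mg); apply: (measurableT_comp (@measurable_cons_pair R n)).
  exact: pair2_measurable.
- by move=> x.
- move=> x; rewrite /= in_itv /= -ler_norml => /negP; rewrite -ltNge => Kx.
  by apply: (gK _ ord0); rewrite tnth_cons0.
Qed.

Lemma Rintegral_tupleS n g : @cube_function n.+1 g ->
  \int[mu n.+1]_t g t = \int[lam]_x \int[mu n]_t g (cons_pair (x, t)).
Proof.
move=> ng; rewrite /Rintegral lebesgue_tupleS//.
rewrite -(integral12_prod_meas1 (cube_function_pair ng)) /fubini_F /=.
congr fine; apply: eq_integral => x _; rewrite fineK//.
exact: integrable_fin_num (cube_function_integrable (cube_function_section x ng)).
Qed.

Lemma Rintegral_tupleS' n g : @cube_function n.+1 g ->
  \int[mu n.+1]_t g t = \int[mu n]_t \int[lam]_x g (cons_pair (x, t)).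
Proof.
move=> ng; rewrite /Rintegral lebesgue_tupleS//.
rewrite -(integral21_prod_meas1 (cube_function_pair ng)) /fubini_G /=.
congr fine; apply: eq_integral => t _; rewrite fineK//.
exact: integrable_fin_num (cube_function_line t ng).
Qed.

Definition set_coord n (t : tR n) (i : 'I_n) (s : R) : tR n :=
  [tuple if j == i then s else tnth t j | j < n].

Lemma set_coord0 n x s (t : tR n) : set_coord (cons_pair (x, t)) ord0 s =
  cons_pair (s, t).
Proof.
apply: eq_from_tnth => j; rewrite tnth_mktuple.
by case: (unliftP ord0 j) => [k|] ->; rewrite ?tnth_consS ?tnth_cons0.
Qed.

Lemma set_coordS n x s (t : tR n) i :
  set_coord (cons_pair (x, t)) (lift ord0 i) s = cons_pair (x, set_coord t i s).
Proof.
apply: eq_from_tnth => j; rewrite tnth_mktuple.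
case: (unliftP ord0 j) => [k|] ->; last by rewrite !tnth_cons0.
by rewrite !tnth_consS tnth_mktuple (inj_eq lift_inj).
Qed.

(** Fubini's theorem, peeling off coordinates until the [i]-th one is
    innermost. *)
Lemma Rintegral_coord_eq0 n g (i : 'I_n) : cube_function g ->
  (forall t, \int[lam]_s g (set_coord t i s) = 0) -> \int[mu n]_t g t = 0.
Proof.
elim: n g i => [g [] //|n IH] g i ng H.
case: (unliftP ord0 i) H => [j|] -> H; last first.
  rewrite Rintegral_tupleS'// (@eq_Rintegral _ _ _ _ _ (fun=> 0)) ?Rintegral_cst
    ?mul0r//.
  move=> t _; rewrite -[RHS](H (cons_pair (0, t))).
  by apply: eq_Rintegral => s _; rewrite set_coord0.
rewrite Rintegral_tupleS// (@eq_Rintegral _ _ _ _ _ (fun=> 0)) ?Rintegral_cst ?mul0r//.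
move=> x _; apply: (IH _ j); first exact: cube_function_section.
move=> t; rewrite -[RHS](H (cons_pair (x, t))).
by apply: eq_Rintegral => s _; rewrite set_coordS.
Qed.

Lemma cube_function_continuous n (G : 'rV[R]_n -> R) K : continuous G ->
  (forall i, line_supported i K G) -> cube_function (G \o @row_of_tuple R n).
Proof.
move=> cG GK; split; first exact: measurable_row_of_tuple.
have [C C0 HC] := continuous_bounded_ball 0 `|K| cG.
exists K, C; split=> t; last by move=> i Kt; apply: (GK i); rewrite mxE.
rewrite /=; have [tK|] := leP `|row_of_tuple t| `|K|; first by apply: HC; rewrite subr0.
rewrite ltNge rV_norm_le// negb_forall => /existsP[k]; rewrite -ltNge => Kt.
by rewrite (GK k) ?normr0//; exact: le_lt_trans (ler_norm K) Kt.
Qed.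

Lemma cube_function_prod n (F : 'I_n -> R -> R) K : (forall i, continuous (F i)) ->
  (forall i, supported K (F i)) -> cube_function (fun t : tR n =>
    \prod_i F i (tnth t i)).
Proof.
move=> cF FK.
rewrite (_ : (fun t => _) = (fun x : 'rV[R]_n =>
  \prod_i F i (x ord0 i)) \o @row_of_tuple R _).
  apply: (@cube_function_continuous _ _ K) => [|i x xK].
    apply: continuous_big => [|i _ x]; first exact: mul_continuous.
    apply: (@continuous_comp _ _ _ (fun x : 'rV[R]_n => x ord0 i) (F i));
      last exact: cF.
    exact: coord_continuous.
  by rewrite (bigD1 i)//= (FK i)// mul0r.
by apply/funext => t /=; apply: eq_bigr => i _; rewrite mxE.
Qed.

Lemma Rintegral_tuple_prod n (F : 'I_n -> R -> R) K : (forall i, continuous (F i)) ->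
  (forall i, supported K (F i)) ->
  \int[mu n]_t (\prod_i F i (tnth t i)) = \prod_i \int[lam]_s F i s.
Proof.
elim: n F => [|n IH] F cF FK.
  rewrite (@eq_Rintegral _ _ _ _ _ (fun=> 1)) => [|t _]; last by rewrite big_ord0.
  rewrite big_ord0 Rintegral_cst//=. by rewrite indicT mul1r.
rewrite Rintegral_tupleS; last exact: cube_function_prod FK.
rewrite big_ord_recl -IH//.
transitivity (\int[lam]_x (F ord0 x * \int[mu n]_t \prod_i F (lift ord0 i) (tnth t i))).
  apply: eq_Rintegral => x _; rewrite -RintegralZl//.
    apply: eq_Rintegral => t _; rewrite big_ord_recl tnth_cons0; congr (_ * _).
    by apply: eq_bigr => i _; rewrite tnth_consS.
  apply: (cube_function_integrable (g := fun t : tR n =>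
    \prod_i F (lift ord0 i) (tnth t i))).
  exact: (@cube_function_prod n (fun i => F (lift ord0 i)) K (fun i =>
    cF _) (fun i => FK _)).
rewrite RintegralZr//; exact: integrable_supported (cF ord0) (FK ord0) _.
Qed.

End tuple_integral.

(** * Moments *)

Section moments.
Variable R : realType.
Local Notation lam := (@lebesgue_measure R).
Variables (F : nat -> R -> R) (K : R).
Hypotheses (dF : forall k (s : R), is_derive s 1 (F k) (F k.+1 s))
  (FK : forall k, supported K (F k)).

Let cF k : continuous (F k).
Proof. by move=> s; apply/differentiable_continuous/derivable1_diffP;
  case: (dF k s). Qed.

Let cX b : continuous (fun s : R => s ^+ b).
Proof. by move=> s; exact: exprn_continuous. Qed.

Let continuous_moment b a : continuous (fun s : R => s ^+ b * F a s).
Proof. by move=> s; apply: (cvgM (F := nbhs s)); [exact: cX|exact: cF]. Qed.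

Let supported_moment b a : supported K (fun s : R => s ^+ b * F a s).
Proof. by move=> s /FK ->; rewrite mulr0. Qed.

Lemma moment_by_parts b a :
  \int[lam]_s (s ^+ b * F a.+1 s) = - (b%:R * \int[lam]_s (s ^+ b.-1 * F a s)).
Proof.
have i1 := integrable_supported (@continuous_moment b a.+1) (@supported_moment b
  a.+1) measurableT.
have i2 := integrable_supported (@continuous_moment b.-1 a) (@supported_moment b.-1
  a) measurableT.
have i3 : lam.-integrable setT (EFin \o (fun s : R => b%:R * (s ^+ b.-1 * F a s))).
  exact: (integrableZl measurableT b%:R i2).
have [] := @FTC_supported R K (fun s : R =>
  s ^+ b * F a.+1 s + b%:R * (s ^+ b.-1 * F a s))
  (fun s : R => s ^+ b * F a s).
- move=> s; apply: (cvgD (F := nbhs s)); first exact: continuous_moment.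
  by apply: (cvgM (F := nbhs s)); [exact: cvg_cst|exact: continuous_moment].
- by move=> s Ks; rewrite !supported_moment// mulr0 addr0.
- exact: supported_moment.
- move=> s; have dX : is_derive s 1 (fun s : R => s ^+ b) (b%:R * s ^+ b.-1).
    apply: DeriveDef; first exact: exprn_derivable.
    by rewrite exp_derive [_ *: 1]mulr1.
  have := @is_deriveM _ _ (fun s : R => s ^+ b) (F a) s 1 _ _ dX (dF a s).
  move=> /is_derive_eq; apply; rewrite /GRing.scale /=; ring.
by rewrite RintegralD// RintegralZl// => /eqP; rewrite addr_eq0 => /eqP.
Qed.

(** Each integration by parts lowers the power and the order of the derivative
    by one; the power [s ^+ 0] is killed first. *)
Lemma moment_vanish b a : (b < a)%N -> \int[lam]_s (s ^+ b * F a s) = 0.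
Proof.
elim: b a => [|b IH] [|a]//; rewrite moment_by_parts; first by rewrite mul0r oppr0.
by move=> ba; rewrite IH// mulr0 oppr0.
Qed.

Lemma moment_diagonal a :
  \int[lam]_s (s ^+ a * F a s) = (-1) ^+ a * (a`!)%:R * \int[lam]_s F 0%N s.
Proof.
elim: a => [|a IH].
  by rewrite expr0 !mul1r; apply: eq_Rintegral => s _; rewrite mul1r.
rewrite moment_by_parts IH factS natrM exprS; ring.
Qed.

End moments.

Section row_integral.
Variables (R : realType) (d : nat).
Local Notation E := 'rV[R]_d.
Local Notation ee i := (delta_mx ord0 i : E).
Local Notation lam := (@lebesgue_measure R).
Local Notation monomial x alpha := (\prod_i x ord0 i ^+ alpha i).
Implicit Types (f g : E -> R) (alpha beta : 'I_d -> nat) (i j : 'I_d).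

Definition row_integral g : R := \int[lebesgue_tuple R d]_t g (row_of_tuple t).

Lemma rtest_cube g : rtest g -> cube_function (g \o @row_of_tuple R d).
Proof. by move=> [sg [K gK]];
  exact: cube_function_continuous (rsmooth_continuous sg) gK. Qed.

Lemma rtest_integrable g : rtest g ->
  (lebesgue_tuple R d).-integrable setT (EFin \o (g \o @row_of_tuple R d)).
Proof. by move=> tg; exact/cube_function_integrable/rtest_cube. Qed.

Lemma row_integralD f g : rtest f -> rtest g ->
  row_integral (fun x => f x + g x) = row_integral f + row_integral g.
Proof.
by move=> /rtest_integrable tf /rtest_integrable tg; rewrite /row_integral -RintegralD.
Qed.

Lemma row_integralZ (c : R) f : rtest f ->
  row_integral (fun x => c * f x) = c * row_integral f.
Proof. by move=> /rtest_integrable tf; rewrite /row_integral -RintegralZl. Qed.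

Lemma row_integral_sum (I : Type) (r : seq I) (F : I -> E ->
  R) : (forall k, rtest (F k)) ->
  row_integral (fun x => \sum_(k <- r) F k x) = \sum_(k <- r) row_integral (F k) /\
  rtest (fun x => \sum_(k <- r) F k x).
Proof.
move=> tF; elim: r => [|k r [IH tr]].
  rewrite (_ : (fun x => _) = fun=> 0); last by apply/funext => x; rewrite big_nil.
  split; last exact: rtest0.
  by rewrite big_nil /row_integral Rintegral_cst// mul0r.
rewrite (_ : (fun x => _) = fun x => F k x + \sum_(k <- r) F k x); last first.
  by apply/funext => x; rewrite big_cons.
by rewrite big_cons row_integralD// IH; split=> //; exact: rtestD.
Qed.

Lemma rsmooth_monomial alpha : rsmooth (fun x : E => monomial x alpha).
Proof. by apply: rsmooth_prod => i; apply: rsmoothX; exact: rsmooth_coord. Qed.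

Definition moment beta f := row_integral (fun x => monomial x beta * f x).

Lemma rtest_monomial beta f : rtest f -> rtest (fun x => monomial x beta * f x).
Proof. by apply: rtestMl; exact: rsmooth_monomial. Qed.

Lemma momentD beta f g : rtest f -> rtest g ->
  moment beta (fun x => f x + g x) = moment beta f + moment beta g.
Proof.
move=> tf tg; rewrite /moment -row_integralD; try exact: rtest_monomial.
by congr row_integral; apply/funext => x; rewrite mulrDr.
Qed.

Lemma momentZ beta (c : R) f : rtest f -> moment beta (fun x =>
  c * f x) = c * moment beta f.
Proof.
move=> tf; rewrite /moment -row_integralZ; last exact: rtest_monomial.
by congr row_integral; apply/funext => x; rewrite mulrCA.
Qed.

Lemma row_set_coord (t : d.-tuple (measurableTypeR R)) i s :
  row_of_tuple (set_coord t i s) = row_of_tuple (set_coord t i 0) + s *: ee i.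
Proof.
apply/rowP => j; rewrite addZ_delta !mxE !tnth_mktuple.
by case: eqP => _; rewrite ?add0r// addr0.
Qed.

Lemma iter_line_is_derive f i (x : E) k (s : R) : rsmooth f ->
  is_derive s 1 (fun s : R => iter k (pd i) f (x + s *: ee i))
    (iter k.+1 (pd i) f (x + s *: ee i)).
Proof. by move=> sf; apply: rsmooth_line; exact: rsmooth_iter_pd. Qed.

(** Integrating first in the [i]-th coordinate leaves a moment of order
    [beta i] of an [M]-fold derivative. *)
Lemma moment_iter_pd M beta i f : rtest f -> (beta i < M)%N ->
  moment beta (iter M (pd i) f) = 0.
Proof.
move=> tf bM; have [sf [r fr]] := tf.
apply: (@Rintegral_coord_eq0 R d _ i).
  exact: (rtest_cube (rtest_monomial beta (rtest_iter_pd M i tf))).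
move=> t; pose z := row_of_tuple (set_coord t i 0).
pose F k (s : R) := iter k (pd i) f (z + s *: ee i).
have dF k (s : R) : is_derive s 1 (F k) (F k.+1 s) by exact: iter_line_is_derive.
have FK k : supported (r + `|z ord0 i|) (F k).
  by apply: supported_line; exact: line_supported_iter_pd.
have := moment_vanish dF FK bM.
have cF : continuous (fun s : R => s ^+ beta i * F M s).
  move=> s; apply: (cvgM (F := nbhs s)); first exact: exprn_continuous.
  by apply/differentiable_continuous/derivable1_diffP; case: (dF M s).
have sF : supported (r + `|z ord0 i|) (fun s : R => s ^+ beta i * F M s).
  by move=> s Ks; rewrite FK// mulr0.
have iF := integrable_supported cF sF measurableT.
move=> mv; have := RintegralZl (\prod_(j | j != i) z ord0 j ^+ beta j) measurableT iF.
rewrite mv mulr0 => <-; apply: eq_Rintegral => s _.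
rewrite row_set_coord -/z (bigD1 i)//= addZ_delta eqxx mulr1n.
have -> : z ord0 i = 0 by rewrite mxE tnth_mktuple eqxx.
rewrite add0r mulrAC mulrC; congr (_ * _).
by apply: eq_bigr => j ji; rewrite addZ_delta (negPf ji) mulr0n addr0.
Qed.

End row_integral.

Section coordinate_bumps.
Variables (R : realType) (d : nat).
Local Notation E := 'rV[R]_d.
Local Notation ee i := (delta_mx ord0 i : E).
Local Notation lam := (@lebesgue_measure R).
Implicit Types (f g : E -> R) (i j : 'I_d).

Lemma line_invariant_factor f i (x : E) : (forall j, j != i -> line_invariant j f) ->
  f x = f (x ord0 i *: ee i).
Proof.
move=> fi; rewrite {1}[x]row_sum_delta (bigD1 i)//=.
elim/big_rec: _ => [|j y ji IH]; first by rewrite addr0.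
by rewrite addrCA addrC fi.
Qed.

(** Restriction of [g] to the line through [x0] in the direction [i], viewed as
    a function of the [i]-th coordinate. *)
Definition line_restriction i (x0 : E) g : E -> R :=
  fun x => g (x0 + (x ord0 i - x0 ord0 i) *: ee i).

Lemma line_restriction_add i j x0 g x (t : R) :
  line_restriction i x0 g (x + t *: ee j) =
  g (x0 + (x ord0 i - x0 ord0 i) *: ee i + (t *+ (i == j)) *: ee i).
Proof.
by rewrite /line_restriction addZ_delta -(addrA x0) -scalerDl addrAC.
Qed.

Lemma is_derive_line_restriction i j x0 g x : rsmooth g ->
  is_derive x (ee j) (line_restriction i x0 g)
    (if i == j then line_restriction i x0 (pd i g) x else 0).
Proof.
move=> sg; have [B HB] : exists B, forall t : R, `|t| <= 1 ->
    `|g (x0 + (x ord0 i - x0 ord0 i) *: ee i + t *: ee i) - line_restriction i x0 g x -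
      t *: line_restriction i x0 (pd i g) x| <= B * `|t| ^+ 2.
  pose y := x0 + (x ord0 i - x0 ord0 i) *: ee i.
  have [B B0 HB] := continuous_bounded_ball y 1
    (rsmooth_continuous (rsmooth_pd i (rsmooth_pd i sg))).
  exists B => t t1; apply: line_taylor sg _ => s st; apply: HB.
  rewrite (addrC y) addrK.
  exact: le_trans (norm_scale_delta i s) (le_trans st t1).
apply: (is_derive_quadratic (C := B)) => t t1; rewrite line_restriction_add.
case: eqP => [ij|ij]; first by rewrite mulr1n; exact: HB.
rewrite mulr0n scale0r addr0 /line_restriction subrr scaler0 subr0 normr0.
by rewrite mulr_ge0 ?exprn_ge0//; apply: le_trans (le_trans (normr_ge0 _) (HB 1 _)) _;
  rewrite ?normr1 ?expr1n ?mulr1.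
Qed.

Lemma rsmooth_line_restriction i x0 g : rsmooth g -> rsmooth (line_restriction i x0 g).
Proof.
move=> sg; apply: (rsmooth_coind (P := fun f => exists2 g, rsmooth g &
  f = line_restriction i x0 g)); last by exists g.
move=> _ [u su ->]; split=> [x|j].
  apply: (@continuous_comp _ _ _ (fun x : E => x0 + (x ord0 i - x0 ord0 i) *: ee i) u).
    apply: (cvgD (F := nbhs x)); first exact: cvg_cst.
    apply: (cvgZ (F := nbhs x)); last exact: cvg_cst.
    apply: (cvgB (F := nbhs x)); last exact: cvg_cst.
    exact: coord_continuous.
  exact: rsmooth_continuous.
split=> [x|]; first by case: (is_derive_line_restriction i j x0 x su).
exists (if i == j then pd i u else fun=> 0).
  by case: ifP => _; [exact: rsmooth_pd|exact: rsmooth_cst].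
apply/funext => x; have [_] := is_derive_line_restriction i j x0 x su.
by rewrite /pd => ->; case: ifP.
Qed.

Lemma Rintegral_gt0 (g : R -> R) K : continuous g -> supported K g ->
  (forall s, 0 <= g s) -> 0 < g 0 -> 0 < \int[lam]_s g s.
Proof.
move=> cg gK g0 gp.
have [e /= e0 He] : exists2 e : R, 0 < e & forall s, `|s| <= e -> g 0 / 2 <= g s.
  have /nbhs_ballP[e /= e0 He] : \forall s \near (0 : R), g 0 / 2 <= g s.
    by apply: (cvgr_ge (F := nbhs (0 : R)) _ (cg 0)); lra.
  exists (e / 2); first by rewrite divr_gt0.
  move=> s se; apply: He; rewrite -ball_normE /= sub0r normrN.
  by apply: le_lt_trans se _; lra.
have mI : measurable (`[- e, e]%classic : set (measurableTypeR R)) by exact: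
  measurable_itv.
have lI : lam `[(- e)%R, e]%classic = (2 * e)%:E.
  by rewrite lebesgue_measure_itv /= lte_fin; case: ltP => ?; rewrite -?EFinB;
    congr (_%:E); lra.
have ig := integrable_supported cg gK measurableT.
have igI := integrable_supported cg gK mI.
apply: (@lt_le_trans _ _ (g 0 / 2 * (2 * e))); first by rewrite !mulr_gt0// divr_gt0.
apply: (@le_trans _ _ (\int[lam]_(s in `[- e, e]) g s)).
  rewrite -[X in _ * X]/(fine (2 * e)%:E) -lI -Rintegral_cst//.
  apply: le_Rintegral => //.
    apply: (measurable_bounded_integrable (f := cst (g 0 / 2))) => //;
      last exact: bounded_cst.
    by rewrite [X in (X < _)%E]lI ltry.
  by move=> s; rewrite /= in_itv /= -ler_norml; exact: He.
rewrite /Rintegral fine_le ?(integrable_fin_num measurableT ig)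
  ?(integrable_fin_num mI igI)//.
apply: ge0_subset_integral => //; first exact: (measurable_int _ ig).
by move=> s _; rewrite lee_fin.
Qed.

(** Any nonzero test function [theta] supplies the one-variable bumps: square
    it, restrict it to a line through a point where it does not vanish, and
    normalise the integral. *)
Lemma coordinate_bumps (theta : E -> R) : rtest theta -> theta <> (fun=> 0) ->
  exists (rho : 'I_d -> E -> R) (r0 : R), [/\ forall i, rsmooth (rho i),
    forall i, line_supported i r0 (rho i),
    forall i j, j != i -> line_invariant j (rho i) &
    forall i, line_total i (rho i) = fun=> 1].
Proof.
move=> [st [r tr]] t0.
have [x0 tx0] : exists x0, theta x0 <> 0.
  by apply: contrapT => /forallNP H; apply: t0; apply/funext => x;
    exact: contrapT (H x).
pose g x := theta x * theta x; have sg : rsmooth g by exact: rsmoothM.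
have gr i : line_supported i r g by move=> x xr; rewrite /g (tr i)// mul0r.
have tot i x : line_total i (line_restriction i x0 g) x = line_total i g x0.
  have inv := line_total_invariant sg (gr i).
  rewrite -[RHS](inv _ (x ord0 i - x0 ord0 i)) /line_total /int_line.
  apply: eq_Rintegral => s _.
  by rewrite line_restriction_add eqxx mulr1n.
have pos i : 0 < line_total i g x0.
  rewrite /line_total /int_line.
  apply: (@Rintegral_gt0 _ (r + `|x0 ord0 i|)).
  - exact/continuous_line/rsmooth_continuous.
  - exact: supported_line.
  - by move=> s; rewrite /g -expr2 sqr_ge0.
  - by rewrite scale0r addr0 /g -expr2 exprn_even_gt0//; exact/eqP.
exists (fun i x => (line_total i g x0)^-1 * line_restriction i x0 g x), r; split.
- by move=> i; apply: rsmoothZ; exact: rsmooth_line_restriction.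
- move=> i x xr; rewrite /line_restriction (gr i) ?mulr0// addZ_delta eqxx mulr1n.
  by rewrite addrC subrK.
- move=> i j ji x t; rewrite line_restriction_add eq_sym (negPf ji) mulr0n scale0r
    addr0.
  by [].
- move=> i; apply/funext => x;
    rewrite -[RHS](mulVf (lt0r_neq0 (pos i))) -[X in _ = _ * X](tot i x).
  have sr := rsmooth_line_restriction i x0 sg.
  have rr : line_supported i r (line_restriction i x0 g).
    move=> y yr; rewrite /line_restriction (gr i)// addZ_delta eqxx mulr1n.
    by rewrite addrC subrK.
  rewrite /line_total /int_line RintegralZl//.
  exact: integrable_line (rsmooth_continuous sr) rr measurableT.
Qed.

End coordinate_bumps.

(** * Distributions with polynomial translates *)

Section solve.
Variables (R : realType) (d M : nat).
Local Notation E := 'rV[R]_d.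
Local Notation ee i := (delta_mx ord0 i : E).
Local Notation lam := (@lebesgue_measure R).
Implicit Types (f g : E -> R) (i j : 'I_d).
Variables (rho : 'I_d -> E -> R) (r0 : R).
Hypotheses (srho : forall i, rsmooth (rho i))
  (rho_supp : forall i, line_supported i r0 (rho i))
  (rho_inv : forall i j, j != i -> line_invariant j (rho i))
  (rho_total : forall i, line_total i (rho i) = fun=> 1).

Let profile i k (s : R) := iter k (pd i) (rho i) (s *: ee i).

Let profile_derive i k (s : R) : is_derive s 1 (profile i k) (profile i k.+1 s).
Proof.
have := iter_line_is_derive i 0 k s (srho i); rewrite add0r.
by under [X in is_derive _ _ X _ -> _]eq_fun do rewrite add0r.
Qed.

Let profile_supported i k : supported r0 (profile i k).
Proof.
move=> s rs; apply: (line_supported_iter_pd _ _ (@rho_supp i)).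
by rewrite !mxE !eqxx mulr1.
Qed.

Let profile_continuous i k : continuous (profile i k).
Proof.
by move=> s; apply/differentiable_continuous/derivable1_diffP;
  case: (profile_derive i k s).
Qed.

Let profile_total i : \int[lam]_s profile i 0 s = 1.
Proof.
have := congr1 (fun g => g 0) (rho_total i); rewrite /line_total /int_line => <-.
by apply: eq_Rintegral => s _; rewrite add0r.
Qed.

Let moment_mx i : 'M[R]_M :=
  \matrix_(a < M, b < M) \int[lam]_s (s ^+ b * profile i a s).

Let moment_mx_unit i : moment_mx i \in unitmx.
Proof.
rewrite unitmxE -det_tr det_trig.
  rewrite unitfE; apply/prodf_neq0 => a _; rewrite !mxE.
  rewrite (moment_diagonal (@profile_derive i) (@profile_supported i))
    profile_total mulr1.
  by rewrite mulf_neq0 ?signr_eq0// pnatr_eq0 -lt0n fact_gt0.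
apply/is_trig_mxP => a b ab; rewrite !mxE.
exact: (moment_vanish (@profile_derive i) (@profile_supported i)).
Qed.

Lemma moment_rho_prod (alpha beta : 'I_d -> nat) :
  moment beta (rho_prod rho d alpha) =
  \prod_i \int[lam]_s (s ^+ beta i * profile i (alpha i) s).
Proof.
rewrite -(@Rintegral_tuple_prod R d _ r0); last 2 first.
- move=> i s; apply: (cvgM (F := nbhs s)); first exact: exprn_continuous.
  exact: profile_continuous.
- by move=> i s rs; rewrite profile_supported// mulr0.
apply: eq_Rintegral => t _.
have -> : rho_prod rho d alpha (row_of_tuple t) =
    \prod_i iter (alpha i) (pd i) (rho i) (row_of_tuple t).
  by apply: eq_bigl => i; rewrite ltn_ord.
rewrite -big_split /=; apply: eq_bigr => i _; rewrite mxE; congr (_ * _).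
rewrite (@line_invariant_factor _ _ _ i) ?mxE// => j ji.
exact/line_invariant_iter_pd/rho_inv.
Qed.

(** The moments of the products of derivatives of the [rho i] form a tensor
    product of triangular matrices, so any values on these products can be
    matched by a combination of the monomials of degree less than [M] in each
    variable. *)
Lemma moment_interpolation (V : lmodType R) (tau : {ffun 'I_d -> 'I_M} -> V) :
  exists a : {ffun 'I_d -> 'I_M} -> V, forall alpha : {ffun 'I_d -> 'I_M},
    tau alpha = \sum_(beta : {ffun 'I_d -> 'I_M})
      moment (fun i => beta i) (rho_prod rho d (fun i => alpha i)) *: a beta.
Proof.
pose B i := invmx (moment_mx i).
exists (fun beta => \sum_(gamma : {ffun 'I_d -> 'I_M})
  (\prod_i B i (beta i) (gamma i)) *: tau gamma) => alpha.
under eq_bigr do rewrite scaler_sumr.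
rewrite exchange_big /=.
have delta (gamma : {ffun 'I_d -> 'I_M}) : \sum_(beta : {ffun 'I_d -> 'I_M})
    moment (fun i => beta i) (rho_prod rho d (fun i => alpha i)) *
    (\prod_i B i (beta i) (gamma i)) = \prod_i ((alpha i == gamma i)%:R : R).
  under [LHS]eq_bigr => beta _ do rewrite moment_rho_prod -big_split /=.
  rewrite -(bigA_distr_bigA (fun i (b : 'I_M) =>
    (\int[lam]_s (s ^+ b * profile i (alpha i) s)) *
    B i b (gamma i))).
  apply: eq_bigr => i _; have := mulmxV (moment_mx_unit i).
  move/matrixP/(_ (alpha i) (gamma i)); rewrite !mxE => <-.
  by apply: eq_bigr => b _; rewrite mxE.
under eq_bigr => gamma _.
  under eq_bigr do rewrite scalerA.
  rewrite -scaler_suml delta; over.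
rewrite (bigD1 alpha)//= big1 ?scale1r => [|i _]; last by rewrite eqxx.
rewrite [X in _ = _ + X]big1 ?addr0// => gamma ga.
have [i ai] : exists i, alpha i != gamma i.
  apply/existsP; apply: contraNT ga; rewrite negb_exists => /forallP H.
  by apply/eqP/ffunP => i; apply/eqP; rewrite eq_sym; apply/negPn.
by rewrite (bigD1 i)//= (negPf ai) mul0r scale0r.
Qed.

End solve.

Section distributions_as_polynomials.
Variables (R : realType) (d : nat).
Local Notation C := (Rcomplex R).
Local Notation E := 'rV[R]_d.
Local Notation ee i := (delta_mx ord0 i : E).
Local Notation Re := (@complex.Re R).
Local Notation Im := (@complex.Im R).
Local Notation monomial x alpha := (\prod_i x ord0 i ^+ alpha i).
Implicit Types (f g : E -> R) (i j : 'I_d) (T : schwartz_distribution R d).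

(** Subtracting from [T] the combination of moments that agrees with it on the
    products of derivatives of the [rho i] leaves a functional to which
    [functional_vanish] applies. *)
Lemma real_representation T M :
  (forall i f, rtest f -> rfun T (iter M (pd i) f) = 0) ->
  exists a : {ffun 'I_d -> 'I_M} -> C, forall f, rtest f ->
    rfun T f = \sum_(beta : {ffun 'I_d -> 'I_M}) moment (fun i => beta i) f *: a beta.
Proof.
move=> Td.
(* If the zero function is the only test function, then [T] is zero; otherwise
   a nonzero one provides the bumps. *)
have [[theta [tt t0]]|H] := pselect (exists theta : E -> R,
  rtest theta /\ theta <> (fun=> 0)); last first.
  exists (fun=> 0) => f tf; have -> : f = fun=> 0 by apply: contrapT => f0;
    apply: H; exists f.
  rewrite big1 => [|beta _]; last by rewrite scaler0.
  have := rfunZ T 0 (@rtest0 R d); rewrite scale0r => <-.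
  by congr rfun; apply/funext => x; rewrite mul0r.
have [rho [r0 [srho rho_supp rho_inv rho_total]]] := coordinate_bumps tt t0.
have [a aE] := moment_interpolation srho rho_supp rho_inv rho_total
  (fun alpha : {ffun 'I_d -> 'I_M} => rfun T (rho_prod rho d (fun i => alpha i))).
exists a; pose J f := \sum_(beta : {ffun 'I_d -> 'I_M}) moment (fun i =>
  beta i) f *: a beta.
move=> f tf; apply/eqP; rewrite -subr_eq0 -/(J f).
apply/eqP; apply: (functional_vanish (M := M) (S := fun f => rfun T f - J f)
  srho rho_supp rho_inv rho_total _ _ _ _ tf).
- move=> g1 g2 tg1 tg2; rewrite rfunD// /J.
  under eq_bigr => beta _ do rewrite momentD// scalerDl.
  by rewrite big_split /= opprD addrACA.
- move=> c g tg; rewrite rfunZ// /J scalerBr scaler_sumr.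
  by congr (_ - _); apply: eq_bigr => beta _; rewrite momentZ// scalerA.
- move=> i g tg; rewrite Td// /J sub0r big1 ?oppr0// => beta _.
  by rewrite moment_iter_pd// scale0r.
- by move=> alpha; rewrite /J -aE subrr.
Qed.

Lemma distr_of_fun_box M (a : {ffun 'I_d -> 'I_M} -> C) (phi : test_function R d) :
  distr_of_fun (fun x => \sum_(beta : {ffun 'I_d ->
    'I_M}) monomial x beta *: a beta) phi =
  \sum_(beta : {ffun 'I_d -> 'I_M}) moment (fun i => beta i) (Re \o phi) *: a beta +
  'i%C * \sum_(beta : {ffun 'I_d -> 'I_M}) moment (fun i =>
    beta i) (Im \o phi) *: a beta.
Proof.
have tR := rtest_part phi (@linear_Re R) (@continuous_Re R).
have tI := rtest_part phi (@linear_Im R) (@continuous_Im R).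
pose G (u v : C -> R) (beta : {ffun 'I_d -> 'I_M}) (x : E) : R :=
  u (a beta) * (monomial x beta * (Re \o phi) x) + v (a beta) * (monomial x beta *
    (Im \o phi) x).
have tG u v beta : rtest (G u v beta).
  by apply: rtestD; apply: rtestZ; exact: rtest_monomial.
have intG u v : row_integral (fun x =>
  \sum_beta G u v beta x) = \sum_(beta : {ffun 'I_d -> 'I_M})
    (u (a beta) * moment (fun i => beta i) (Re \o phi) +
     v (a beta) * moment (fun i => beta i) (Im \o phi)).
  have [-> _] := row_integral_sum (index_enum _) (tG u v).
  apply: eq_bigr => beta _; rewrite row_integralD; try by apply: rtestZ;
    exact: rtest_monomial.
  by rewrite !row_integralZ; try exact: rtest_monomial.
rewrite /distr_of_fun /integral_rV.
have Re_sum (F : {ffun 'I_d -> 'I_M} ->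
  C) : Re (\sum_beta F beta) = \sum_beta Re (F beta).
  by elim/big_rec2: _ => [//|i x y _ <-]; case: (F i) y => ? ? [].
have Im_sum (F : {ffun 'I_d -> 'I_M} ->
  C) : Im (\sum_beta F beta) = \sum_beta Im (F beta).
  by elim/big_rec2: _ => [//|i x y _ <-]; case: (F i) y => ? ? [].
rewrite [X in Complex X _](_ : _ =
    row_integral (fun x => \sum_beta G Re (fun z => - Im z) beta x)); last first.
  apply: eq_Rintegral => t _; rewrite -/(row_of_tuple t) mulr_suml Re_sum.
  apply: eq_bigr => beta _; rewrite /G /=.
  by case: (a beta) (phi _) => u v [p q] /=; ring.
rewrite [X in Complex _ X](_ : _ = row_integral (fun x =>
  \sum_beta G Im Re beta x)); last first.
  apply: eq_Rintegral => t _; rewrite -/(row_of_tuple t) mulr_suml Im_sum.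
  apply: eq_bigr => beta _; rewrite /G /=.
  by case: (a beta) (phi _) => u v [p q] /=; ring.
rewrite !intG mulr_sumr -big_split /=; apply/eqP; rewrite eq_complex Re_sum Im_sum /=.
by apply/andP; split; apply/eqP; apply: eq_bigr => beta _;
  case: (a beta) => u v /=; ring.
Qed.

(** Translating the test function turns the equation for [T] into the same
    equation for the function [x |-> T (phi (. + x))]. *)
Lemma iter_difference_orbit h m (S : test_function R d -> C)
    (phi : test_function R d) :
  iter m (difference (translate (- h))) (fun x => S (test_translate x phi)) =
  fun x => iter m (difference (distr_translate h)) S (test_translate x phi).
Proof.
elim: m S => [//|m IH] S; rewrite !iterSr -IH; congr (iter _ _ _).
apply/funext => x; rewrite differenceE; congr (_ - _).
rewrite /distr_translate; congr S; apply: test_function_ext.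
by apply/funext => y; rewrite /= /translate addrAC addrA.
Qed.

Lemma orbit_difference T m h f : rtest f ->
  iter m (difference (distr_translate h)) (distr_fun T) = 0 ->
  iter m (difference (translate h)) (orbit_fun T f) = 0.
Proof.
move=> tf Th; rewrite -[h]opprK; apply: iter_Delta_opp.
have -> : orbit_fun T f = fun x => T (test_translate x (test_of tf)).
  apply/funext => x; rewrite /orbit_fun (rfunE _ (rtest_shift x tf)).
  by congr (distr_fun T _); exact: test_function_ext.
by rewrite (iter_difference_orbit h m (distr_fun T)) Th.
Qed.

(** Along the [i]-th axis [T (f (. + t e_i))] is a polynomial in [t] of degree
    less than [M], so [T] vanishes on [M]-fold derivatives. *)
Lemma distribution_polynomial T M :
  (forall f, rtest f -> line_polynomial M (orbit_fun T f)) ->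
  exists a : {ffun 'I_d -> 'I_M} -> C, forall phi : test_function R d,
    T phi = distr_of_fun (fun x =>
      \sum_(beta : {ffun 'I_d -> 'I_M}) monomial x beta *: a beta) phi.
Proof.
move=> TP.
have [a aE] : exists a : {ffun 'I_d -> 'I_M} -> C, forall f, rtest f ->
    rfun T f = \sum_(beta : {ffun 'I_d -> 'I_M}) moment (fun i => beta i) f *: a beta.
  apply: real_representation => i f tf; have [p sp pE] := TP f tf 0 (ee i).
  apply: (rfun_iter_pd (a := fun k => p`_k) tf) => t; rewrite -[t *: _]add0r pE.
  rewrite (horner_coef_wide _ sp); apply: eq_bigr => k _.
  rewrite mulrC -[RHS]mulr_algl; congr (_ * _).
  exact/esym/(rmorphXn (GRing.in_alg C)).
exists a => phi; rewrite distr_of_fun_box distr_parts.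
by rewrite !aE//; apply: rtest_part;
  [exact: linear_Im|exact: continuous_Im|exact: linear_Re|exact: continuous_Re].
Qed.

End distributions_as_polynomials.

Lemma sum_ffun1 (R : realType) m (hd : (0 < 1)%N) (x : 'rV[R]_1)
    (a : {ffun 'I_1 -> 'I_m} -> Rcomplex R) :
  \sum_(beta : {ffun 'I_1 -> 'I_m}) (\prod_i x ord0 i ^+ beta i) *: a beta =
  \sum_(j < m) x ord0 (Ordinal hd) ^+ j *: a [ffun=> j].
Proof.
rewrite (reindex (fun j : 'I_m => [ffun=> j] : {ffun 'I_1 -> 'I_m})) /=.
  by apply: eq_bigr => j _; rewrite big_ord1 ffunE; congr (x _ _ ^+ _ *: _);
    exact: val_inj.
exists (fun beta : {ffun 'I_1 -> 'I_m} => beta ord0) => [j _|beta _];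
  first by rewrite ffunE.
by apply/ffunP => i; rewrite ffunE (ord1 i).
Qed.

Theorem theorem2p12 (R : realType) (d ell m : nat)
    (hd : (0 < d)%N) (hell : (0 < ell)%N) (hm : (0 < m)%N)
    (h : 'I_ell -> 'rV[R]_d)
    (hdense : dense [set x : 'rV[R]_d |
       exists n : 'I_ell -> int, x = \sum_(k < ell) h k *~ n k]) :
  (forall f : 'rV[R]_d -> Rcomplex R, continuous f ->
     (forall k : 'I_ell, iter m (difference (translate (h k))) f = 0) ->
     (exists (N : nat) (a : {ffun 'I_d -> 'I_N} -> Rcomplex R),
        forall x, f x = polynomial_fun a x) /\
     (d = 1%N -> exists a : 'I_m -> Rcomplex R,
        forall x, f x = \sum_(j < m) x ord0 (Ordinal hd) ^+ j *: a j)) /\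
  (forall T : schwartz_distribution R d,
     (forall k : 'I_ell,
        iter m (difference (distr_translate (h k))) (distr_fun T) = 0) ->
     (exists (N : nat) (a : {ffun 'I_d -> 'I_N} -> Rcomplex R),
        forall phi : test_function R d,
          T phi = distr_of_fun (polynomial_fun a) phi) /\
     (d = 1%N -> exists a : 'I_m -> Rcomplex R,
        forall phi : test_function R d,
          T phi = distr_of_fun
            (fun x => \sum_(j < m) x ord0 (Ordinal hd) ^+ j *: a j) phi)).
Proof.
case: m hm => [//|m] _; split=> [f cf fD|T TD].
  split.
    have [b bE] := box_polynomial (lattice_line_polynomial hdense cf fD).
    have [N [a aE]] := polynomial_fun_box b hd.
    by exists N, a => x; rewrite bE aE.
  move=> d1; subst d.
  have [b bE] := box_polynomial (lattice_line_polynomial1 hdense cf fD).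
  by exists (fun j => b [ffun=> j]) => x; rewrite bE sum_ffun1.
have orbitD g : rtest g -> forall k,
    iter m.+1 (difference (translate (h k))) (orbit_fun T g) = 0.
  by move=> tg k; exact: orbit_difference.
split.
  have [b bE] := distribution_polynomial (fun g (tg : rtest g) =>
    lattice_line_polynomial hdense (continuous_orbit (T := T) tg) (orbitD g tg)).
  have [N [a aE]] := polynomial_fun_box b hd.
  by exists N, a => phi; rewrite bE; congr distr_of_fun; exact/funext.
move=> d1; subst d.
have [b bE] := distribution_polynomial (fun g (tg : rtest g) =>
  lattice_line_polynomial1 hdense (continuous_orbit (T := T) tg) (orbitD g tg)).
exists (fun j => b [ffun=> j]) => phi; rewrite bE; congr distr_of_fun.
by apply/funext => x; rewrite sum_ffun1.
Qed.
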